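(* Let $\Phi$ be a nearest-neighbor interaction and let $\mu\in\mathscr G^\Gamma(\Phi)$. For every weak* neighborhood $\mathcal U_1$ of $\mu$ and every $t,\varepsilon>0$ there exist a weak* neighborhood $\mathcal U_0$ of $\mu$ and $\delta>0$ such that the following holds: for every finite set $V$ and every $\sigma\in\mathrm{Hom}(\Gamma,\mathrm{Sym}(V))$ with $\Delta^\sigma<\delta$, and every $\mathbf x_0\in\Omega(\sigma,\mathcal U_0)$, with probability at least $1-\varepsilon$ the Glauber dynamics $(\mathbf x_s)$ for $\Phi$ on $\sigma$ started at $\mathbf x_0$ satisfies $\mathbf x_s\in\Omega(\sigma,\mathcal U_1)$ for all $s\in[0,t]$.
   Context: Setting. Let $\Gamma$ be a countably infinite group generated by $s_1,\dots,s_r$, and let $S=\{s_1^{\pm1},\dots,s_r^{\pm1}\}$. For $\gamma\in\Gamma$, $|\gamma|$ is the graph distance from $e$ to $\gamma$ in the left Cayley graph (vertex set $\Gamma$, a directed $s_i$-labeled edge $(\gamma,s_i\gamma)$ for each $\gamma\in\Gamma$, $i\in[r]$). For a finite alphabet $\mathtt A$, $\Gamma$ acts on $\mathtt A^\Gamma$ by $(\beta\mathbf x)(\gamma)=\mathbf x(\gamma\beta)$; $\mathrm{Prob}^\Gamma(\mathtt A^\Gamma)$ is the set of shift-invariant Borel probability measures on $\mathtt A^\Gamma$. $\mathtt A^\Gamma$ carries the metric $d(\mathbf x,\mathbf y)=\sum_{\gamma}(3r)^{-|\gamma|}\mathbf 1_{\mathbf x(\gamma)\ne\mathbf y(\gamma)}$,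 and $\mathrm{Prob}(\mathtt A^\Gamma)$ carries $\bar d(\mu,\nu)=\sup\{|\int f\,d\mu-\int f\,d\nu|: f \text{ 1-Lipschitz}\}$, which metrizes the weak* topology. Sofic notation. For a finite set $V$ and $\sigma\in\mathrm{Hom}(\Gamma,\mathrm{Sym}(V))$ (write $\sigma^\gamma=\sigma(\gamma)$), the graph of $\sigma$ has a directed $s_i$-labeled edge $(v,\sigma^{s_i}v)$ for each $v\in V$, $i\in[r]$. For $\mathbf x\in\mathtt A^V$, $\Pi^\sigma_v\mathbf x=(\mathbf x(\sigma^\gamma v))_{\gamma\in\Gamma}$ and the empirical distribution is $P^\sigma_{\mathbf x}=\frac1{|V|}\sum_{v\in V}\delta_{\Pi^\sigma_v\mathbf x}$. For $\mathcal O\subseteq\mathrm{Prob}(\mathtt A^\Gamma)$, $\Omega(\sigma,\mathcal O)=\{\mathbf x\in\mathtt A^V:P^\sigma_{\mathbf x}\in\mathcal O\}$. For $R\in\mathbb N$, $\delta^\sigma_R$ is the fraction of $v\in V$ whose radius-$R$ ball in the graph of $\sigma$ is not isomorphic (as rooted, directed, edge-labeled graphs) to the radius-$R$ ball around $e$ in the Cayley graph; $\Delta^\sigma=\inf_R\big(9(2/3)^R+6\delta^\sigma_R\big)$. Interactions and Glauber dynamics. A nearest-neighbor interaction is $\Phi=(J,h)$ with $J:\mathtt A^2\to\mathbb R$ symmetric and $h:\mathtt A\to\mathbb R$. Let $V$ be either finite with $\sigma\in\mathrm{Hom}(\Gamma,\mathrm{Sym}(V))$, or $V=\Gamma$ with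 $\sigma^\gamma v=\gamma v$. For $\mathbf x\in\mathtt A^V$, $\mathbf x^{v\to\mathtt a}$ equals $\mathbf x$ off $v$ and $\mathtt a$ at $v$. Put $\Phi_v(\mathbf x)=h(\mathbf x(v))+\sum_{s\in S}J(\mathbf x(v),\mathbf x(\sigma^sv))$ and $c_v(\mathbf x,\mathtt a)=e^{-\Phi_v(\mathbf x^{v\to\mathtt a})}/\sum_{\mathtt b\in\mathtt A}e^{-\Phi_v(\mathbf x^{v\to\mathtt b})}$. The Glauber dynamics is the continuous-time Markov process on $\mathtt A^V$ with generator $\Omega f(\mathbf x)=\sum_{v}\sum_{\mathtt a}c_v(\mathbf x,\mathtt a)[f(\mathbf x^{v\to\mathtt a})-f(\mathbf x)]$ (for $V=\Gamma$, the closure of this operator on smooth functions); equivalently, each site has an independent rate-1 Poisson clock and at a ring at $v$ the spin at $v$ is resampled from $c_v(\mathbf x,\cdot)$. Its semigroup is $S^\sigma(t)$ (finite $V$) or $S^\Gamma(t)$ ($V=\Gamma$), with generators $\Omega^\sigma,\Omega^\Gamma$. $\mathbf x_t$ denotes the random evolution to time $t$ of the initial configuration $\mathbf x_0$. Gibbs measures. $\mu\in\mathrm{Prob}(\mathtt A^\Gamma)$ is Gibbs for $\Phi$ if for every $\gamma\in\Gamma$ and bounded measurable $f$, $\int\sum_{\mathtt a}c_\gamma(\mathbf x,\mathtt a)f(\mathbf x^{\gamma\to\mathtt a})\,\mu(d\mathbf x)=\int f\,d\mu$ (with $V=\Gamma$). $\mathscr G(\Phi)$ is the set of Gibbs measures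 and $\mathscr G^\Gamma(\Phi)=\mathscr G(\Phi)\cap\mathrm{Prob}^\Gamma(\mathtt A^\Gamma)$. *)

(* Defs.v *)
From HB Require Import structures.
From mathcomp Require Import all_boot all_order all_algebra.
From mathcomp Require Import all_classical all_reals all_analysis.
Set Implicit Arguments.
Unset Strict Implicit.
Unset Printing Implicit Defensive.
Import Order.TTheory GRing.Theory Num.Theory.
Local Open Scope classical_set_scope.
Local Open Scope ring_scope.

Record group_law (G : Type) := GroupLaw {
  gmul : G -> G -> G;
  ginv : G -> G;
  gone : G;
  gmulA : forall x y z, gmul x (gmul y z) = gmul (gmul x y) z;
  gmul1 : forall x, gmul gone x = x;
  gmulV : forall x, gmul (ginv x) x = gone }.

Section Group.
Variables (Gam : countType) (gl : group_law Gam) (r : nat) (s : 'I_r -> Gam).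

Definition inS (g : Gam) : Prop := exists i, g = s i \/ g = ginv gl (s i).

Definition Sseq : seq Gam :=
  undup ([seq s i | i <- enum 'I_r] ++ [seq ginv gl (s i) | i <- enum 'I_r]).

Definition is_word (w : seq Gam) : Prop := forall g, g \in w -> inS g.
Definition wordval (w : seq Gam) : Gam := foldr (gmul gl) (gone gl) w.

Definition generates : Prop :=
  forall g : Gam, exists w, is_word w /\ wordval w = g.

Definition represents (n : nat) (g : Gam) : Prop :=
  exists w, is_word w /\ size w = n /\ wordval w = g.

Definition wlen (g : Gam) : nat :=
  xget 0%N [set n | represents n g /\ forall m, represents m g -> (n <= m)%N].

Definition inCball (Rad : nat) (g : Gam) : Prop :=
  exists w, is_word w /\ (size w <= Rad)%N /\ g = wordval w.

Section Alphabet.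
Variables (R : realType) (A : finType) (a0 : A).

(* configurations A^Gamma, with the Borel (= cylinder) sigma-algebra *)
Definition conf0 of A := Gam -> A.  (* tagged by the point a0 *)
HB.instance Definition _ := Choice.on (conf0 a0).
HB.instance Definition _ := isPointed.Build (conf0 a0) (fun _ => a0).

Definition cyl : set (set (conf0 a0)) :=
  [set E | exists (g : Gam) (a : A), E = [set x | x g = a]].

Definition conf := g_sigma_algebraType cyl.

(* the metric d on A^Gamma (extended-real valued; it is always finite) *)
Definition confdist (x y : conf) : \bar R :=
  (\esum_(g in [set: Gam])
     (((3 * r)%:R ^- wlen g) * (x g != y g)%:R)%:E)%E.


Definition Lip1 : set (conf -> R) :=
  [set f | forall x y : conf, (`|f x - f y|%:E <= confdist x y)%E].

Definition shift (b : Gam) (x : conf) : conf := fun g => x (gmul gl g b).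

Definition shift_invariant (mu : probability conf R) : Prop :=
  forall (b : Gam) (E : set conf), measurable E -> mu (shift b @^-1` E) = mu E.

Definition int_meas (mu : probability conf R) (f : conf -> R) : \bar R :=
  (\int[mu]_x (f x)%:E)%E.

(* dbar between two "measures" given by their integration functionals *)
Definition dbarI (I1 I2 : (conf -> R) -> \bar R) : \bar R :=
  ereal_sup [set (`|I1 f - I2 f|)%E | f in Lip1].

Section Local.
Variables (J : A -> A -> R) (h : A -> R).
Variables (W : eqType) (nbr : Gam -> W -> W).
(* nbr g v = sigma^g v  (finite V)   or   g v  (V = Gamma) *)

Definition upd (x : W -> A) (v : W) (a : A) : W -> A :=
  fun w => if w == v then a else x w.

Definition Phi_at (x : W -> A) (v : W) : R :=
  h (x v) + \sum_(g <- Sseq) J (x v) (x (nbr g v)).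

Definition crate (x : W -> A) (v : W) (a : A) : R :=
  expR (- Phi_at (upd x v a) v) / \sum_(b : A) expR (- Phi_at (upd x v b) v).
End Local.

Definition is_gibbs (J : A -> A -> R) (h : A -> R) (mu : probability conf R) : Prop :=
  forall (g : Gam) (f : conf -> R),
    measurable_fun [set: conf] f -> (exists M : R, forall x, `|f x| <= M) ->
    int_meas mu (fun x : conf =>
        \sum_(a : A) crate J h (gmul gl) x g a * f (upd x g a : conf))
    = int_meas mu f.

Section Finite.
Variables (V : finType) (sig : Gam -> V -> V).

Definition is_hom : Prop :=
  (forall g, bijective (sig g)) /\
  (forall g1 g2 v, sig (gmul gl g1 g2) v = sig g1 (sig g2 v)).

Definition Pi (x : {ffun V -> A}) (v : V) : conf := fun g => x (sig g v).

Definition int_emp (x : {ffun V -> A}) (f : conf -> R) : \bar R :=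
  ((#|V|%:R)^-1 * \sum_(v : V) f (Pi x v))%:E.

Definition dbar_emp (mu : probability conf R) (x : {ffun V -> A}) : \bar R :=
  dbarI (int_meas mu) (int_emp x).

Definition inSball (Rad : nat) (v u : V) : Prop :=
  exists w, is_word w /\ (size w <= Rad)%N /\ u = sig (wordval w) v.

Definition ball_iso (Rad : nat) (v : V) : Prop :=
  exists phi : Gam -> V,
    phi (gone gl) = v /\
    (forall g, inCball Rad g -> inSball Rad v (phi g)) /\
    (forall g1 g2, inCball Rad g1 -> inCball Rad g2 -> phi g1 = phi g2 -> g1 = g2) /\
    (forall u, inSball Rad v u -> exists g, inCball Rad g /\ phi g = u) /\
    (forall g1 g2 (i : 'I_r), inCball Rad g1 -> inCball Rad g2 ->
        (g2 = gmul gl (s i) g1 <-> phi g2 = sig (s i) (phi g1))).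

Definition delta_R (Rad : nat) : R :=
  #|[set v : V | ~~ `[< ball_iso Rad v >]]|%:R / #|V|%:R.

Definition Delta : R :=
  inf [set 9 * (2 / 3) ^+ Rad + 6 * delta_R Rad | Rad in [set: nat]].

Variables (J : A -> A -> R) (h : A -> R).

Definition updf (x : {ffun V -> A}) (v : V) (a : A) : {ffun V -> A} :=
  [ffun w => if w == v then a else x w].

(* jump kernel at a ring of the total clock (rate |V|): a uniform site v
   rings and its spin is resampled from c_v(x, .) *)
Definition Kjump (x y : {ffun V -> A}) : R :=
  (#|V|%:R)^-1 *
  \sum_(v : V) \sum_(a : A) crate J h sig x v a * (y == updf x v a)%:R.

Fixpoint stayN (B : set {ffun V -> A}) (n : nat) (x : {ffun V -> A}) : R :=
  match n with
  | 0%N => (`[< B x >])%:R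
  | n'.+1 => (`[< B x >])%:R * \sum_(y : {ffun V -> A}) Kjump x y * stayN B n' y
  end.

(* P( x_s in B for all s in [0,t] ) for the Glauber dynamics started at x0:
   condition on the number n of clock rings in [0,t], which is
   Poisson(|V| t) distributed. *)
Definition glauber_stay_prob (t : R) (B : set {ffun V -> A}) (x0 : {ffun V -> A})
  : \bar R :=
  (\sum_(0 <= n <oo)
     (expR (- (#|V|%:R * t)) * (#|V|%:R * t) ^+ n / (n`!)%:R * stayN B n x0)%:E)%E.

End Finite.
End Alphabet.
End Group.

(* Main.v *)
Require Import Defs.
From HB Require Import structures.
From mathcomp Require Import all_boot all_order all_algebra.
From mathcomp Require Import all_classical all_reals all_analysis.
From mathcomp Require Import measurable_realfun ring lra.
Set Implicit Arguments.
Unset Strict Implicit.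
Unset Printing Implicit Defensive.
Import Order.TTheory GRing.Theory Num.Theory.
Import numFieldNormedType.Exports.
Local Open Scope classical_set_scope.
Local Open Scope ring_scope.

(** A finite-volume argument in discrete time. Let [Q] be the jump chain on
    the [V]-configurations. On the [|V| T] steps that matter (Markov's
    inequality for the Poisson number of rings), changing one spin influences
    [Q^k F] through weights that decay like [(3r)^-|gamma|] and grow at most by
    a factor [exp (c T)], whatever the interaction.
    - Pulled back along [gamma |-> sigma^gamma v], for a vertex [v] with a good
      ball, [Q] differs from the chain on [Gam] which only updates sites of a
      ball by the updates on the sphere, whose total influence is of order
      [(2/3)^R]. As [mu] is Gibbs it is exactly invariant under this local
      chain, so the expected empirical average of a local function stays close
      to its [mu]-mean.
    - The martingale [Q^(n-k) F (x_k)] has increments of order [1/|V|], so the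
      empirical average has variance of order [1/|V|], and [|V|] is large
      because [Gam] is infinite.
    - Between times of a grid of mesh [tau |V|] the empirical averages move
      deterministically by at most a constant times [tau]; a union bound over
      the boundedly many grid times concludes. *)

(** * Influence of one site under the heat-bath chain *)

Section Dynamics.
Variables (R : realType) (Gam : countType) (gl : group_law Gam) (r : nat).
Variables (s : 'I_r -> Gam) (A : finType) (J : A -> A -> R) (h : A -> R).

(** The spin at the site itself is overwritten, so the rate depends only on the neighbouring spins
    and on which neighbours coincide with the site. Allowing two site types lets this compare [V]
    with [Gam]. *)
Lemma eq_crate (W W' : eqType) (nbr : Gam -> W -> W) (nbr' : Gam -> W' -> W')
    (x : W -> A) (x' : W' -> A) v v' a :
  (forall g, g \in Sseq gl s -> (nbr g v == v) = (nbr' g v' == v')) ->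
  (forall g, g \in Sseq gl s -> x (nbr g v) = x' (nbr' g v')) ->
  crate gl s J h nbr x v a = crate gl s J h nbr' x' v' a.
Proof.
move=> eqv eqx.
have eqPhi b : Phi_at gl s J h nbr (upd x v b) v =
               Phi_at gl s J h nbr' (upd x' v' b) v'.
  rewrite /Phi_at /upd !eqxx; congr (_ + _); apply: eq_big_seq => g gS.
  by rewrite eqv // eqx.
by rewrite /crate eqPhi; congr (_ / _); apply: eq_bigr => b _; rewrite eqPhi.
Qed.

Variables (W : eqType) (nbr : Gam -> W -> W).
Implicit Types (G H : (W -> A) -> R) (x : W -> A) (v w : W).
Local Notation c := (crate gl s J h nbr).

Lemma crate_ge0 x v a : 0 <= c x v a.
Proof.
by rewrite /crate divr_ge0 ?expR_ge0 // sumr_ge0 // => b _; rewrite expR_ge0.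
Qed.

Lemma sum_crate x v : \sum_a c x v a = 1.
Proof.
rewrite /crate -mulr_suml divff // gt_eqF //.
rewrite (bigD1 (x v)) //= ltr_pwDl ?expR_gt0 //.
by apply: sumr_ge0 => b _; rewrite expR_ge0.
Qed.

Definition heat v G x : R := \sum_a c x v a * G (upd x v a).

Lemma ler_heat v G H x : (forall y, G y <= H y) -> heat v G x <= heat v H x.
Proof. by move=> GH; apply: ler_sum => a _; rewrite ler_wpM2l ?crate_ge0. Qed.

Lemma heat_cst v (k : R) x : heat v (fun=> k) x = k.
Proof. by rewrite /heat -mulr_suml sum_crate mul1r. Qed.

Lemma heat_affine v G H (k l : R) x :
  heat v (fun y => k * G y + l * H y) x = k * heat v G x + l * heat v H x.
Proof.
rewrite /heat !mulr_sumr -big_split /=; apply: eq_bigr => a _; ring.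
Qed.

Lemma heat_sub_le v G x (e : R) :
  (forall a, `|G (upd x v a) - G x| <= e) -> `|heat v G x - G x| <= e.
Proof.
move=> Ge; rewrite -[X in _ - X](heat_cst v (G x) x) /heat -sumrB.
apply: le_trans (ler_norm_sum _ _ _) _.
rewrite -[leRHS]mul1r -(sum_crate x v) mulr_suml; apply: ler_sum => a _.
by rewrite -mulrBr normrM ger0_norm ?crate_ge0 // ler_wpM2l ?crate_ge0.
Qed.

Definition osc_le G (e : W -> R) :=
  forall x v a, `|G (upd x v a) - G x| <= e v.

Lemma upd_upd x v a b : upd (upd x v a) v b = upd x v b.
Proof. by apply: funext => w; rewrite /upd; case: eqP. Qed.

Lemma updC x v w a b : v != w ->
  upd (upd x v a) w b = upd (upd x w b) v a.
Proof.
move=> vw; apply: funext => u; rewrite /upd.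
by case: (eqVneq u w) => // ->; rewrite eq_sym (negbTE vw).
Qed.

(** The spin at [w] acts on the argument of [G], with the rates kept, and on the rates. The latter
    requires [w] to be [v] or a neighbour of [v]; two probability vectors then differ by at most 2
    in total, whatever the interaction. *)
Lemma heat_osc G (e : W -> R) v x w b : osc_le G e ->
  `|heat v G (upd x w b) - heat v G x| <=
  e w + 2 * (\sum_(u <- v :: [seq nbr g v | g <- Sseq gl s]) (w == u)%:R * e v).
Proof.
move=> Ge; set x' := upd x w b; set N := v :: _.
have e_ge0 u : 0 <= e u := le_trans (normr_ge0 _) (Ge x u b).
have -> : heat v G x' - heat v G x =
    \sum_a c x' v a * (G (upd x' v a) - G (upd x v a)) +
    \sum_a (c x' v a - c x v a) * (G (upd x v a) - G x).
  rewrite -big_split /= /heat -sumrB.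
  (* Both rate vectors sum to 1, so [G x] may be subtracted in the second sum, leaving increments
     bounded by [e v]. *)
  have zero : 0 = - (\sum_a (c x' v a - c x v a) * G x).
    by rewrite -mulr_suml sumrB !sum_crate subrr mul0r oppr0.
  rewrite -[LHS]addr0 [X in _ + X]zero -sumrN -big_split /=; apply: eq_bigr => a _; ring.
apply: le_trans (ler_normD _ _) _; apply: lerD.
- rewrite -[leRHS]mul1r -(sum_crate x' v) mulr_suml.
  apply: le_trans (ler_norm_sum _ _ _) _; apply: ler_sum => a _.
  rewrite normrM ger0_norm ?crate_ge0 // ler_wpM2l ?crate_ge0 //.
  (* Resampling [w] itself erases the change made there. *)
  have [vw|vw] := eqVneq w v; last by rewrite /x' updC //; exact: Ge.
  by rewrite /x' vw upd_upd subrr normr0 e_ge0.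
- have [wN|wN] := boolP (w \in N); last first.
    rewrite big1 => [|a _]; last first.
      rewrite (_ : c x' v a = c x v a) ?subrr ?mul0r //.
      apply: eq_crate => // g gS; rewrite /x' /upd; case: eqP => // E.
      by move: wN; rewrite inE negb_or -E map_f ?andbF.
    by rewrite normr0 mulr_ge0 // sumr_ge0 // => u _; rewrite mulr_ge0.
  apply: (@le_trans _ _ (2 * e v)); last first.
    rewrite ler_pM2l // (big_rem _ wN) /= eqxx mul1r lerDl sumr_ge0 // => u _.
    by rewrite mulr_ge0.
  have -> : 2 * e v = \sum_a (c x' v a + c x v a) * e v.
    by rewrite -mulr_suml big_split /= !sum_crate; ring.
  apply: le_trans (ler_norm_sum _ _ _) _; apply: ler_sum => a _.
  rewrite normrM; apply: ler_pM => //.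
  apply: le_trans (ler_normB _ _) _.
  by rewrite !ger0_norm ?crate_ge0.
Qed.

(* One step of the chain that, with probability [(size L) / N], resamples a
   uniform site of [L], and otherwise does nothing. *)
Definition glauber (N : nat) (L : seq W) G x : R :=
  G x + N%:R^-1 * \sum_(v <- L) (heat v G x - G x).

Section Chain.
Variables (N : nat) (L : seq W).
Hypotheses (N_gt0 : (0 < N)%N) (LN : (size L <= N)%N).
Local Notation Q := (glauber N L).

Lemma glauberE G x :
  Q G x = (1 - N%:R^-1 * (size L)%:R) * G x + N%:R^-1 * \sum_(v <- L) heat v G x.
Proof.
rewrite /glauber sumrB big_const_seq count_predT iter_addr_0 -[G x *+ _]mulr_natr.
ring.
Qed.

Let rest_ge0 : 0 <= 1 - N%:R^-1 * (size L)%:R :> R.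
Proof. by rewrite subr_ge0 ler_pdivrMl ?ltr0n // mulr1 ler_nat. Qed.

Let invN_ge0 : 0 <= N%:R^-1 :> R. Proof. by rewrite invr_ge0. Qed.

Lemma ler_glauber G H x : (forall y, G y <= H y) -> Q G x <= Q H x.
Proof.
move=> GH; rewrite !glauberE lerD ?ler_wpM2l //.
by apply: ler_sum => v _; exact: ler_heat.
Qed.

Lemma glauber_cst (k : R) x : Q (fun=> k) x = k.
Proof.
by rewrite /glauber big1 ?mulr0 ?addr0 // => v _; rewrite heat_cst subrr.
Qed.

Lemma glauber_affine G H (k l : R) x :
  Q (fun y => k * G y + l * H y) x = k * Q G x + l * Q H x.
Proof.
rewrite /glauber.
under eq_bigr do rewrite heat_affine.
have -> : \sum_(v <- L) (k * heat v G x + l * heat v H x - (k * G x + l * H x))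
   = k * (\sum_(v <- L) (heat v G x - G x)) + l * (\sum_(v <- L) (heat v H x - H x)).
  by rewrite !mulr_sumr -big_split /=; apply: eq_bigr => v _; ring.
ring.
Qed.

Lemma glauber_lip G H (e : R) x :
  (forall y, `|G y - H y| <= e) -> `|Q G x - Q H x| <= e.
Proof.
move=> GH.
have GHe y : -e <= 1 * G y + (-1) * H y <= e.
  by rewrite mul1r mulN1r -ler_norml.
have := ler_glauber x (fun y => proj1 (andP (GHe y))).
have := ler_glauber x (fun y => proj2 (andP (GHe y))).
rewrite !glauber_affine !glauber_cst ler_norml; lra.
Qed.

(** A variance is at most the second moment about any constant, here about the current value [G x],
    from which one step deviates by at most [e]. *)
Lemma glauber_variance G (e : R) x : 0 <= e -> osc_le G (fun=> e) ->
  Q (fun y => G y ^+ 2) x - (Q G x) ^+ 2 <= e ^+ 2.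
Proof.
move=> e0 Ge; set k := G x.
have : Q (fun y => (G y - k) ^+ 2) x <= e ^+ 2.
  rewrite /glauber subrr expr0n /= add0r.
  rewrite ler_pdivrMl ?ltr0n //.
  apply: (@le_trans _ _ (\sum_(v <- L) e ^+ 2)).
    apply: ler_sum => v _; rewrite subr0.
    apply: (@le_trans _ _ (heat v (fun=> e ^+ 2) x)); last by rewrite heat_cst.
    apply: ler_sum => a _; rewrite ler_wpM2l ?crate_ge0 //.
    by rewrite -real_normK ?num_real // lerXn2r ?nnegrE //; exact: Ge.
  rewrite big_const_seq count_predT iter_addr_0 -[_ *+ _]mulr_natl.
  by rewrite ler_wpM2r ?sqr_ge0 ?ler_nat.
have -> : (fun y => (G y - k) ^+ 2) =
  (fun y => 1 * G y ^+ 2 + 1 * ((- 2 * k) * G y + (k ^+ 2) * 1)).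
  by apply: funext => y; ring.
rewrite !glauber_affine glauber_cst.
have := sqr_ge0 (Q G x - k); lra.
Qed.

Lemma iter_glauber_le G H n x :
  (forall y, G y <= H y) -> iter n Q G x <= iter n Q H x.
Proof.
by move=> GH; elim: n x => [|n IH] x //=; apply: ler_glauber.
Qed.

Lemma iter_glauber_cst n (k : R) x : iter n Q (fun=> k) x = k.
Proof.
suff -> : iter n Q (fun=> k) = (fun=> k) by [].
by elim: n => //= n ->; apply: funext => y; rewrite glauber_cst.
Qed.

Lemma iter_glauber_affine n G H (k l : R) x :
  iter n Q (fun y => k * G y + l * H y) x = k * iter n Q G x + l * iter n Q H x.
Proof.
suff -> : iter n Q (fun y => k * G y + l * H y) =
  (fun y => k * iter n Q G y + l * iter n Q H y) by [].
by elim: n => //= n ->; apply: funext => y; rewrite glauber_affine.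
Qed.

Lemma iter_glauber_sum n (I : Type) (t : seq I) (k : R) (F : I -> (W -> A) -> R) x :
  iter n Q (fun y => k * \sum_(i <- t) F i y) x = k * \sum_(i <- t) iter n Q (F i) x.
Proof.
rewrite -[RHS]addr0 -[X in _ = _ + X](mul0r (iter n Q (fun=> 0) x)).
have -> : (fun y => k * \sum_(i <- t) F i y) =
  (fun y => k * (\sum_(i <- t) F i y) + 0 * 0).
  by apply: funext => y; rewrite mul0r addr0.
rewrite iter_glauber_affine; congr (_ * _ + _).
elim: t => [|i t IH].
  rewrite big_nil (_ : (fun y => _) = fun=> 0) ?iter_glauber_cst //.
  by apply: funext => y; rewrite big_nil.
rewrite big_cons -IH -[X in _ = X + _]mul1r -[X in _ = _ + X]mul1r.
rewrite -iter_glauber_affine.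
congr (iter n Q _ x); apply: funext => y; rewrite big_cons; ring.
Qed.

Lemma iter_glauber_lip n G H (e : R) x :
  (forall y, `|G y - H y| <= e) -> `|iter n Q G x - iter n Q H x| <= e.
Proof. by move=> GH; elim: n x => [|n IH] x //=; exact: glauber_lip. Qed.

(** Orthogonality of martingale increments: the variance of [n.+1] steps is the average over the
    first step of the variance of the other [n], plus the one-step variance of [iter n Q G]. *)
Lemma iter_glauber_variance n G (e : nat -> R) (E : R) x :
  (forall k, (k < n)%N -> 0 <= e k <= E) ->
  (forall k, (k < n)%N -> osc_le (iter k Q G) (fun=> e k)) ->
  iter n Q (fun y => G y ^+ 2) x - (iter n Q G x) ^+ 2 <= n%:R * E ^+ 2.
Proof.
elim: n x => [|n IH] x e_ge0 Ge; first by rewrite /= subrr mul0r.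
pose V y := 1 * iter n Q (fun y => G y ^+ 2) y + (-1) * (iter n Q G y) ^+ 2.
have IHn y : V y <= n%:R * E ^+ 2.
  by rewrite /V mul1r mulN1r; apply: IH => k kn; [apply: e_ge0|apply: Ge];
    exact: ltnW.
have /andP[en0 enE] := e_ge0 n (ltnSn n).
have Vx := ler_glauber x IHn.
have := glauber_variance x en0 (Ge n (ltnSn n)).
rewrite /V glauber_affine glauber_cst /= -natr1 in Vx *.
have : e n ^+ 2 <= E ^+ 2 by rewrite lerXn2r ?nnegrE // (le_trans en0).
lra.
Qed.

(** * Weighted influence over many steps *)

Section Influence.
Variables (kappa : R) (wt : W -> R).
Hypotheses (uniqL : uniq L) (wt_ge0 : forall v, 0 <= wt v) (kappa_ge1 : 1 <= kappa).
Hypothesis nbr_inj : forall g, g \in Sseq gl s -> injective (nbr g).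
Hypothesis wt_nbr :
  forall g v, g \in Sseq gl s -> wt v <= kappa * wt (nbr g v).

Lemma sum_nbr_le (f : W -> W) w : injective f ->
  (forall v, wt v <= kappa * wt (f v)) ->
  \sum_(v <- L) (w == f v)%:R * wt v <= kappa * wt w.
Proof.
move=> f_inj wtf; have k0 : 0 <= kappa by exact: le_trans kappa_ge1.
elim: L uniqL => [|v l IH] /=; first by rewrite big_nil mulr_ge0.
move=> /andP[vl ul]; rewrite big_cons; have [wv|_] := eqVneq w (f v); last first.
  by rewrite mul0r add0r IH.
rewrite big1_seq ?mul1r ?addr0 ?wv // => u /= ul'.
have [/f_inj uv|_] := eqVneq (f v) (f u); last by rewrite mul0r.
by rewrite uv ul' in vl.
Qed.

(** After exchanging the sums, injectivity leaves, for each generator and for the site itself, at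
    most one [v] that sees [w]; its weight is at most [kappa * wt w]. *)
Lemma influence_le w :
  \sum_(v <- L) \sum_(u <- v :: [seq nbr g v | g <- Sseq gl s]) (w == u)%:R * wt v
   <= (size (Sseq gl s)).+1%:R * (kappa * wt w).
Proof.
under eq_bigr do rewrite big_cons big_map.
rewrite big_split /= -natr1 mulrDl mul1r addrC exchange_big /=.
apply: lerD; last first.
  apply: (@sum_nbr_le id) => // v; rewrite ler_peMl //.
rewrite mulr_natl -iter_addr_0 -(count_predT (Sseq gl s)) -big_const_seq big_seq [leRHS]big_seq.
by apply: ler_sum => g gS; apply: sum_nbr_le; [exact: nbr_inj|move=> v; exact: wt_nbr].
Qed.

Let C : R := 2 * (size (Sseq gl s)).+1%:R * kappa.

(** The first term of [heat_osc], summed over [L], restores exactly the mass missing from the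
    holding probability. Only the influence between neighbours remains, which gives the factor
    [1 + C / N]. *)
Lemma glauber_osc G (D : R) : 0 <= D ->
  osc_le G (fun v => D * wt v) ->
  osc_le (Q G) (fun v => D * (1 + C / N%:R) * wt v).
Proof.
move=> D0 GD x w b; rewrite !glauberE.
set q := 1 - _; set q' := N%:R^-1.
have -> : q * G (upd x w b) + q' * (\sum_(v <- L) heat v G (upd x w b)) -
  (q * G x + q' * \sum_(v <- L) heat v G x) =
  q * (G (upd x w b) - G x) +
  q' * \sum_(v <- L) (heat v G (upd x w b) - heat v G x).
  by rewrite sumrB; ring.
apply: le_trans (ler_normD _ _) _.
rewrite !normrM (ger0_norm rest_ge0) (ger0_norm invN_ge0) -/q -/q'.
apply: (@le_trans _ _ (q * (D * wt w) +
    q' * ((size L)%:R * (D * wt w) + C * (D * wt w)))); last first.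
  by rewrite /q -/q' le_eqVlt; apply/orP; left; apply/eqP; ring.
apply: lerD; first by rewrite ler_wpM2l ?rest_ge0.
rewrite ler_wpM2l ?invN_ge0 //.
apply: le_trans (ler_norm_sum _ _ _) _.
apply: le_trans (ler_sum _ (fun v _ => heat_osc v x w b GD)) _.
rewrite big_split /= big_const_seq count_predT iter_addr_0 -[X in X + _]mulr_natl. rewrite lerD2l.
rewrite -mulr_sumr; under eq_bigr do under eq_bigr do rewrite mulrCA.
under eq_bigr do rewrite -mulr_sumr.
rewrite -mulr_sumr.
apply: le_trans (ler_wpM2l _ (ler_wpM2l D0 (influence_le w))) _; first by [].
by rewrite /C le_eqVlt; apply/orP; left; apply/eqP; ring.
Qed.

Lemma iter_glauber_osc G (D T : R) n : 0 <= D -> n%:R <= T * N%:R ->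
  osc_le G (fun v => D * wt v) ->
  osc_le (iter n Q G) (fun v => D * expR (C * T) * wt v).
Proof.
move=> D0 nT GD.
have k0 : 0 <= kappa by exact: le_trans kappa_ge1.
have C0 : 0 <= C / N%:R by rewrite divr_ge0 ?mulr_ge0.
have H : osc_le (iter n Q G) (fun v => D * (1 + C / N%:R) ^+ n * wt v).
  elim: n {nT} => [|n IH]; first by move=> x v a; rewrite expr0 mulr1; exact: GD.
  move=> x v a; rewrite exprSr mulrA; apply: glauber_osc => //.
  by rewrite mulr_ge0 // exprn_ge0 // addr_ge0.
move=> x v a; apply: le_trans (H x v a) _.
rewrite ler_wpM2r // ler_wpM2l //.
apply: le_trans (_ : expR (C / N%:R) ^+ n <= _).
  by rewrite lerXn2r ?nnegrE ?expR_ge0 ?expR_ge1Dx // addr_ge0.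
rewrite -expRM_natl ler_expR [leLHS]mulrCA ler_wpM2l ?mulr_ge0 //.
by rewrite ler_pdivrMr ?ltr0n.
Qed.

End Influence.
End Chain.
End Dynamics.

(** * Word metric *)

Section WordMetric.
Variables (Gam : countType) (gl : group_law Gam) (r : nat) (s : 'I_r -> Gam).
Implicit Types (g x y : Gam) (n : nat).
Local Notation mul := (gmul gl).
Local Notation inv := (ginv gl).
Local Notation one := (gone gl).

Lemma gmulKg g x : mul (inv g) (mul g x) = x.
Proof. by rewrite gmulA gmulV gmul1. Qed.

Lemma gmulVr g : mul g (inv g) = one.
Proof.
by rewrite -[LHS](gmulKg (inv g)) [mul (inv g) _]gmulA gmulV gmul1 gmulV.
Qed.

Lemma gmulVKg g x : mul g (mul (inv g) x) = x.
Proof. by rewrite gmulA gmulVr gmul1. Qed.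

Lemma gmul_inj g : injective (mul g).
Proof. exact: can_inj (gmulKg g). Qed.

Lemma mem_SseqP g : reflect (inS gl s g) (g \in Sseq gl s).
Proof.
rewrite /Sseq mem_undup mem_cat; apply: (iffP orP).
  by case=> /mapP[i _ ->]; exists i; [left|right].
by case=> i [->|->]; [left|right]; apply: map_f; rewrite mem_enum.
Qed.

Lemma size_Sseq : (size (Sseq gl s) <= 2 * r)%N.
Proof.
apply: leq_trans (size_undup _) _.
by rewrite size_cat !size_map -enumT size_enum_ord mul2n addnn.
Qed.

Fixpoint words n : seq Gam :=
  if n is n'.+1 then [seq mul g x | g <- Sseq gl s, x <- words n']
  else [:: one].

Lemma size_words n : size (words n) = (size (Sseq gl s) ^ n)%N.
Proof. by elim: n => //= n IH; rewrite size_allpairs IH expnS. Qed.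

Lemma mem_wordsP n g : reflect (represents gl s n g) (g \in words n).
Proof.
elim: n g => [|n IH] g /=.
  rewrite inE; apply: (iffP eqP) => [->|[[|a w] [_ []]]] //.
  by exists [::]; split=> // ?.
apply: (iffP allpairsP) => [[[a x] /= [aS /IH[w [wS [sw <-]]] ->]]|].
  exists (a :: w); split; last by rewrite /= sw.
  by move=> b; rewrite inE => /orP[/eqP->|/wS//]; apply/mem_SseqP.
case=> [[|a w] [wS [//= [sw] <-]]]; exists (a, wordval gl w) => /=; split => //.
  by apply/mem_SseqP; apply: wS; rewrite inE eqxx.
by apply/IH; exists w; split=> // b bw; apply: wS; rewrite inE bw orbT.
Qed.

Lemma words_inCball n m g : (n <= m)%N -> g \in words n -> inCball gl s m g.
Proof. by move=> nm /mem_wordsP[w [wS [sw <-]]]; exists w; rewrite sw. Qed.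

Definition ball n : seq Gam := undup (flatten [seq words k | k <- iota 0 n.+1]).

Lemma ball_uniq n : uniq (ball n). Proof. exact: undup_uniq. Qed.

Hypothesis Ggen : generates gl s.
Local Notation len := (wlen gl s).

Lemma wlen_spec g : represents gl s (len g) g /\
  forall m, represents gl s m g -> (len g <= m)%N.
Proof.
apply: (@xgetPex _ 0%N [set n | represents gl s n g /\
  forall m, represents gl s m g -> (n <= m)%N]).
have ex : exists n, g \in words n.
  by have [w [wS wg]] := Ggen g; exists (size w); apply/mem_wordsP; exists w.
case: (ex_minnP ex) => n /mem_wordsP ng nmin; exists n; split=> // m /mem_wordsP.
exact: nmin.
Qed.

Lemma mem_words_wlen g : g \in words (len g).
Proof. by apply/mem_wordsP; case: (wlen_spec g). Qed.

Lemma wlen_le n g : g \in words n -> (len g <= n)%N.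
Proof. by move=> /mem_wordsP; case: (wlen_spec g) => _; exact. Qed.

Lemma mem_ball n g : (g \in ball n) = (len g <= n)%N.
Proof.
rewrite /ball mem_undup; apply/flatten_mapP/idP => [[k]|gn].
  by rewrite mem_iota add0n ltnS => /= kn /wlen_le /leq_trans; exact.
by exists (len g); [rewrite mem_iota|exact: mem_words_wlen].
Qed.

Lemma ball_inCball n g : g \in ball n -> inCball gl s n g.
Proof. by rewrite mem_ball => gn; apply: words_inCball gn (mem_words_wlen g). Qed.

Lemma wlen1 : len one = 0%N.
Proof. by apply/eqP; rewrite -leqn0; apply: wlen_le; rewrite inE. Qed.

Lemma wlen_mul g x : g \in Sseq gl s -> (len (mul g x) <= (len x).+1)%N.
Proof.
by move=> gS; apply: wlen_le; apply/allpairsP; exists (g, x); rewrite mem_words_wlen.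
Qed.

Lemma ball_subset m n : (m <= n)%N -> {subset ball m <= ball n}.
Proof. by move=> mn g; rewrite !mem_ball => /leq_trans; exact. Qed.

Lemma ball_unbounded (Ginf : infinite_set [set: Gam]) M :
  exists n, (M <= size (ball n))%N.
Proof.
have [B _ BM] := infinite_set_fset M Ginf.
exists (\max_(g <- finmap.enum_fset B) len g)%N; apply: leq_trans BM _.
apply: uniq_leq_size; first exact: finmap.fset_uniq.
by move=> g gB; rewrite mem_ball (leq_bigmax_seq _ gB isT).
Qed.

Variable R : realType.
Hypothesis r_gt0 : (0 < r)%N.
Local Notation kappa := ((3 * r)%:R : R).

Lemma kappa_ge1 : 1 <= kappa.
Proof. by rewrite ler1n muln_gt0. Qed.

Let kappa_gt0 : 0 < kappa. Proof. exact: lt_le_trans kappa_ge1. Qed.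

(** At most [(2r)^n] elements have length [n], and each has weight [(3r)^-n]. *)
Lemma sphere_sum (B : seq Gam) n : uniq B ->
  \sum_(g <- B | len g == n) kappa ^- len g <= (2 / 3) ^+ n.
Proof.
move=> uB; rewrite -big_filter big_seq.
rewrite (eq_bigr (fun=> kappa ^- n)) => [|g]; last first.
  by rewrite mem_filter => /andP[/eqP->].
rewrite -big_seq big_const_seq count_predT iter_addr_0 -[X in X <= _]mulr_natl.
rewrite ler_pdivrMr ?exprn_gt0 // -exprMn.
have -> : 2 / 3 * kappa = (2 * r)%:R by rewrite !natrM; field.
rewrite -natrX ler_nat.
apply: (@leq_trans (size (words n))).
  apply: uniq_leq_size; first exact: filter_uniq.
  by move=> g; rewrite mem_filter => /andP[/eqP <- _]; exact: mem_words_wlen.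
rewrite size_words; elim: n => // n IH; rewrite !expnS leq_mul //; exact: size_Sseq.
Qed.

Lemma tail_sum (B : seq Gam) n : uniq B ->
  \sum_(g <- B | (n <= len g)%N) kappa ^- len g <= 3 * (2 / 3) ^+ n.
Proof.
move=> uB.
(* The telescoping bound absorbs each shell exactly: [3 ((2/3)^m - (2/3)^(m+1)) = (2/3)^m]. *)
have shell k : \sum_(g <- B | (n <= len g < n + k)%N) kappa ^- len g
    <= 3 * ((2 / 3) ^+ n - (2 / 3) ^+ (n + k)).
  elim: k => [|k IH].
    rewrite addn0 subrr mulr0 big_pred0 // => g.
    by rewrite leqNgt andNb.
  rewrite (bigID (fun g => len g == n + k)%N) /=.
  rewrite (eq_bigl (fun g => len g == n + k)%N); last first.
    move=> g; case: (eqVneq (len g) (n + k)%N) => [->|]; last by rewrite andbF.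
    by rewrite leq_addr addnS ltnS leqnn.
  rewrite [X in _ + X](eq_bigl (fun g => n <= len g < n + k)%N); last first.
    by move=> g; rewrite addnS ltnS [in RHS]ltn_neqAle -andbA; congr (_ && _);
      rewrite andbC.
  have := sphere_sum (n + k) uB; rewrite addnS exprS; lra.
pose M := (\max_(g <- B) len g).+1.
rewrite big_seq_cond (eq_bigl (fun g => (g \in B) && (n <= len g < n + M)%N)); last first.
  move=> g; case: (boolP (g \in B)) => //= gB.
  by rewrite [(_ < n + M)%N](_ : _ = true) ?andbT // ltn_addl // ltnS (leq_bigmax_seq _ gB isT).
rewrite -big_seq_cond; apply: le_trans (shell M) _.
by rewrite ler_pM2l // lerBlDr lerDl exprn_ge0.
Qed.

Variables (A : finType) (a0 : A).
Implicit Types (u v : conf Gam a0).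

Lemma confdist_le n u v : (forall g, (len g < n)%N -> u g = v g) ->
  (confdist gl s R u v <= (3 * (2 / 3) ^+ n)%:E)%E.
Proof.
move=> uv; apply: ge_ereal_sup => _ [X [finX _] <-].
rewrite fsbig_finite //= sumEFin lee_fin.
apply: le_trans (tail_sum n (finmap.fset_uniq (fset_set X))).
rewrite [leRHS]big_mkcond; apply: ler_sum => g _.
have [gn|gn] := leqP n (len g).
  by rewrite ler_piMr ?lern1 ?leq_b1 // invr_ge0 exprn_ge0.
by rewrite uv // eqxx mulr0.
Qed.

Lemma confdist_ge n u v g : (len g <= n)%N -> u g != v g ->
  ((kappa ^- n)%:E <= confdist gl s R u v)%E.
Proof.
move=> gn uv; apply: esum_ge; exists [set g]; first by split.
rewrite fsbig_set1 uv mulr1 lee_fin lef_pV2 ?posrE ?exprn_gt0 //.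
by rewrite ler_weXn2l // kappa_ge1.
Qed.

Lemma confdist_fin u v : (confdist gl s R u v <= 3%:E)%E.
Proof. by rewrite -[3]mulr1 -(expr0 (2 / 3)); apply: confdist_le. Qed.

End WordMetric.

(** * Local functions and the Gibbs property *)

Section Measure.
Variables (Gam : countType) (gl : group_law Gam) (r : nat) (s : 'I_r -> Gam).
Hypothesis Ggen : generates gl s.
Variables (R : realType) (A : finType) (a0 : A).
Local Notation conf := (conf Gam a0).
Implicit Types (B : seq Gam) (x y : Gam -> A).

(** The target type is left free: [Prop] gives local events, [R] local functions. *)
Definition local_on (T : Type) B (f : (Gam -> A) -> T) :=
  forall x y, {in B, x =1 y} -> f x = f y.

(** Induction on [B]: split along the spin at [b], which is a generating event, and freeze that
    spin, so that only the remaining sites matter. *)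
Lemma measurable_local_set B (E : set conf) : local_on B E -> measurable E.
Proof.
elim: B E => [|b B IH] E EB.
  have [E0|E0] := pselect (E (fun=> a0)).
    rewrite (_ : E = setT); first exact: measurableT.
    by apply/seteqP; split=> // x _; rewrite (EB x (fun=> a0)).
  rewrite (_ : E = set0); first exact: measurable0.
  by apply/seteqP; split=> // x; rewrite (EB x (fun=> a0)).
rewrite (_ : E = \bigcup_(a in [set: A])
    ([set x : conf | x b = a] `&` [set x : conf | E (upd x b a)])); last first.
  have updE x : upd x b (x b) = x.
    by apply: funext => g; rewrite /upd; case: eqP => // ->.
  apply/seteqP; split=> x.
    by move=> Ex; exists (x b) => //; split=> //=; rewrite updE.
  by case=> a _ [/= <-]; rewrite updE.
apply: fin_bigcup_measurable; first exact: finite_finset.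
move=> a _; apply: measurableI.
  by apply: sub_sigma_algebra; exists b, a.
apply: IH => x y xy /=; apply: EB => g; rewrite inE /upd.
by case: (eqVneq g b) => //= _ /xy.
Qed.

Lemma measurable_local B (f : conf -> R) :
  local_on B f -> measurable_fun [set: conf] f.
Proof.
move=> fB _ Y mY; rewrite setTI; apply: (@measurable_local_set B) => x y xy.
by rewrite /preimage /= (fB x y xy).
Qed.

Variable mu : probability conf R.

Definition mean (f : conf -> R) : R := \int[mu]_x f x.

Definition bounded_measurable (f : conf -> R) :=
  measurable_fun [set: conf] f /\ exists M : R, forall x, `|f x| <= M.

Lemma bounded_measurable_integrable f : bounded_measurable f ->
  mu.-integrable [set: conf] (EFin \o f).
Proof.
case=> mf [M fM]; apply: measurable_bounded_integrable => //.
- exact: le_lt_trans (probability_le1 mu measurableT) (ltry 1).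
- exists M; split; first exact: num_real.
  by move=> N MN x _; exact: le_trans (fM x) (ltW MN).
Qed.

Lemma int_meas_mean f : bounded_measurable f -> int_meas mu f = (mean f)%:E.
Proof.
move=> /bounded_measurable_integrable fi; rewrite /mean /Rintegral fineK //.
exact: integrable_fin_num.
Qed.

Lemma bounded_measurable_cst (k : R) : bounded_measurable (fun=> k).
Proof. by split; [exact: measurable_cst|exists `|k|]. Qed.

Lemma bounded_measurable_affine f g (k l : R) :
  bounded_measurable f -> bounded_measurable g ->
  bounded_measurable (fun x => k * f x + l * g x).
Proof.
move=> [mf [M fM]] [mg [M' gM]]; split.
  by apply: measurable_funD; apply: measurable_funM.
exists (`|k| * M + `|l| * M') => x; apply: le_trans (ler_normD _ _) _.
by rewrite !normrM lerD // ler_wpM2l.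
Qed.

Lemma mean_cst (k : R) : mean (fun=> k) = k.
Proof. by rewrite /mean Rintegral_cst //= probability_setT /= mulr1. Qed.

Lemma mean_affine f g (k l : R) :
  bounded_measurable f -> bounded_measurable g ->
  mean (fun x => k * f x + l * g x) = k * mean f + l * mean g.
Proof.
move=> fb gb.
have scale_int (c : R) h : bounded_measurable h ->
    mu.-integrable [set: conf] (EFin \o (fun x => c * h x)).
  move=> hb; apply: bounded_measurable_integrable.
  have -> : (fun x => c * h x) = (fun x => c * h x + 0 * 0).
    by apply: funext => x; rewrite mulr0 addr0.
  exact: bounded_measurable_affine hb (bounded_measurable_cst 0).
rewrite /mean RintegralD ?RintegralZl //; try exact: scale_int.
all: exact: bounded_measurable_integrable.
Qed.

Lemma bounded_measurable_sum (I : Type) (t : seq I) (F : I -> conf -> R) :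
  (forall i, bounded_measurable (F i)) ->
  bounded_measurable (fun x => \sum_(i <- t) F i x) /\
  mean (fun x => \sum_(i <- t) F i x) = \sum_(i <- t) mean (F i).
Proof.
move=> Fb; elim: t => [|i t [IHb IHm]].
  rewrite big_nil (_ : (fun x => _) = fun=> 0); last first.
    by apply: funext => x; rewrite big_nil.
  by rewrite mean_cst; split => //; exact: bounded_measurable_cst.
rewrite (_ : (fun x => _) = fun x => 1 * F i x + 1 * \sum_(j <- t) F j x).
  split; first exact: bounded_measurable_affine.
  by rewrite mean_affine // IHm !mul1r big_cons.
by apply: funext => x; rewrite big_cons !mul1r.
Qed.

Lemma mean_lip f g (e : R) : bounded_measurable f -> bounded_measurable g ->
  (forall x, `|f x - g x| <= e) -> `|mean f - mean g| <= e.
Proof.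
move=> fb gb fge.
have -> : mean f - mean g = mean (fun x => 1 * f x + -1 * g x).
  by rewrite mean_affine // mul1r mulN1r.
have fgb := bounded_measurable_affine 1 (-1) fb gb.
have bnd x : - e <= 1 * f x + -1 * g x <= e by rewrite mul1r mulN1r -ler_norml.
rewrite ler_norml -{1}(mean_cst (- e)) -[X in _ && (_ <= X)](mean_cst e).
apply/andP; split; apply: le_Rintegral => //.
all: try by apply: bounded_measurable_integrable => //; exact: bounded_measurable_cst.
- by move=> x _; case/andP: (bnd x).
- by move=> x _; case/andP: (bnd x).
Qed.

Variables (J : A -> A -> R) (h : A -> R).
Hypothesis mu_gibbs : is_gibbs gl s J h mu.
Variable n : nat.
Local Notation mul := (gmul gl).
Local Notation Q N := (glauber gl s J h mul N (ball gl s n)).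

Lemma local_bounded_measurable B f (M : R) : local_on B f ->
  (forall x, `|f x| <= M) -> bounded_measurable f.
Proof. by move=> fB fM; split; [exact: measurable_local fB|exists M]. Qed.

(** Resampling a site at distance at most [n] reads its neighbours, hence the radius [n.+1]. *)
Lemma local_heat g f : g \in ball gl s n -> local_on (ball gl s n.+1) f ->
  local_on (ball gl s n.+1) (heat gl s J h mul g f).
Proof.
rewrite mem_ball // => gn fB x y xy; apply: eq_bigr => a _; congr (_ * _).
  apply: eq_crate => // b bS; apply: xy; rewrite mem_ball //.
  exact: leq_trans (wlen_mul Ggen _ bS) _.
by apply: fB => b bB; rewrite /upd xy.
Qed.

Lemma local_glauber N f : local_on (ball gl s n.+1) f ->
  local_on (ball gl s n.+1) (Q N f).
Proof.
move=> fB x y xy; rewrite /glauber (fB x y) //; congr (_ + _ * _).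
by apply: eq_big_seq => g gB; rewrite (local_heat gB fB xy).
Qed.

Lemma heat_bound g (f : (Gam -> A) -> R) (M : R) x :
  (forall x, `|f x| <= M) -> `|heat gl s J h mul g f x| <= M.
Proof.
move=> fM; rewrite -[leRHS](heat_cst gl s J h mul g M x).
apply: le_trans (ler_norm_sum _ _ _) _; apply: ler_sum => a _.
by rewrite normrM ger0_norm ?crate_ge0 // ler_wpM2l ?crate_ge0.
Qed.

(** The Gibbs property, applied at each updated site, makes the mean of every term [heat g f - f]
    vanish. *)
Lemma mean_glauber N f (M : R) : local_on (ball gl s n.+1) f ->
  (forall x, `|f x| <= M) -> mean (Q N f) = mean f.
Proof.
move=> fB fM; have fb := local_bounded_measurable fB fM.
(* The value 0 off the ball makes [F] bounded and measurable at every index, as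
   [bounded_measurable_sum] requires. *)
pose F g := if g \in ball gl s n then fun x => 1 * heat gl s J h mul g f x + -1 * f x
            else fun=> 0.
have heatb g : g \in ball gl s n -> bounded_measurable (heat gl s J h mul g f).
  move=> gB; apply: local_bounded_measurable (local_heat gB fB) (_ : forall x, _ <= M).
  by move=> x; exact: heat_bound.
have Fb g : bounded_measurable (F g).
  rewrite /F; case: ifPn => gB; last exact: bounded_measurable_cst.
  by apply: bounded_measurable_affine => //; exact: heatb.
have [sb sm] := bounded_measurable_sum (ball gl s n) Fb.
rewrite (_ : Q N f = fun x => 1 * f x + N%:R^-1 * \sum_(g <- ball gl s n) F g x).
  rewrite mean_affine // sm big1_seq ?mulr0 ?addr0 ?mul1r // => g /= gB.
  rewrite /F gB mean_affine //; last exact: heatb.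
  apply/eqP; rewrite mul1r mulN1r subr_eq0 -(inj_eq (@EFin_inj R)).
  rewrite -!int_meas_mean //; last exact: heatb.
  by apply/eqP; apply: mu_gibbs; case: fb => // mf _; exists M.
apply: funext => x; rewrite /glauber mul1r; congr (_ + _ * _).
by apply: eq_big_seq => g gB; rewrite /F gB mul1r mulN1r.
Qed.

End Measure.

(** * The transport distance and finite patterns *)

Section Transport.
Variables (Gam : countType) (gl : group_law Gam) (r : nat) (s : 'I_r -> Gam).
Hypothesis Ggen : generates gl s.
Hypothesis r_gt0 : (0 < r)%N.
Variables (R : realType) (A : finType) (a0 : A).
Variables (mu : probability (conf Gam a0) R).
Local Notation conf := (conf Gam a0).
Local Notation kappa := ((3 * r)%:R : R).

Definition trunc n (x : Gam -> A) : Gam -> A :=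
  fun g => if (wlen gl s g < n)%N then x g else a0.

Lemma local_trunc n (f : conf -> R) :
  local_on (ball gl s n) (fun x => f (trunc n x)).
Proof.
move=> x y xy; congr f; apply: funext => g; rewrite /trunc; case: ifP => // gn.
by apply: xy; rewrite mem_ball // ltnW.
Qed.

Lemma Lip1_le (f : conf -> R) (x y : conf) (e : R) : Lip1 gl s f ->
  (confdist gl s R x y <= e%:E)%E -> `|f x - f y| <= e.
Proof. by move=> /(_ x y) fL /(le_trans fL); rewrite lee_fin. Qed.

Lemma Lip1_trunc n (f : conf -> R) (x : conf) : Lip1 gl s f ->
  `|f x - f (trunc n x)| <= 3 * (2 / 3) ^+ n.
Proof.
move=> fL; apply: (Lip1_le fL); apply: confdist_le => // g gn.
by rewrite /trunc gn.
Qed.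

Lemma cvg_geometric23 : (fun n => 3 * (2 / 3) ^+ n : R) @ \oo --> (0 : R).
Proof.
rewrite -[0](mulr0 3); apply: cvgM; first exact: cvg_cst.
by apply: cvg_expr; rewrite ger0_norm //; lra.
Qed.

(** Measurability comes from the approximation by the local functions [f (trunc n x)], and
    boundedness from the diameter of the space, at most 3. *)
Lemma Lip1_bounded_measurable (f : conf -> R) :
  Lip1 gl s f -> bounded_measurable f.
Proof.
move=> fL; split; last first.
  exists (3 + `|f (fun=> a0)|) => x.
  rewrite -lerBlDr; apply: le_trans (lerB_dist _ _) _.
  by apply: (Lip1_le fL); exact: confdist_fin.
apply: (measurable_fun_cvg (h := fun n (x : conf) => f (trunc n x))).
  by move=> n; apply: measurable_local; exact: local_trunc.
move=> x _; apply/cvgrPdist_le => e e0.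
have /cvgrPdist_le/(_ e e0) := cvg_geometric23.
apply: filterS => n; rewrite sub0r normrN ger0_norm ?mulr_ge0 ?exprn_ge0 //.
exact: le_trans (Lip1_trunc n x fL).
Qed.

Section Empirical.
Variables (V : finType) (sig : Gam -> V -> V).
Hypothesis V_gt0 : (0 < #|V|)%N.
Implicit Types (x : V -> A).

(** This is [Pi] on plain functions [V -> A], the configurations on which [glauber] acts. *)
Definition pull x v : Gam -> A := fun g => x (sig g v).

Definition emp x (f : (Gam -> A) -> R) : R :=
  #|V|%:R^-1 * \sum_(v : V) f (pull x v).

Let V_neq0 : #|V|%:R != 0 :> R. Proof. by rewrite pnatr_eq0 -lt0n. Qed.

Lemma emp_cst x (k : R) : emp x (fun=> k) = k.
Proof. by rewrite /emp sumr_const -[k *+ _]mulr_natl mulKf. Qed.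

Lemma emp_affine x f g (k l : R) :
  emp x (fun y => k * f y + l * g y) = k * emp x f + l * emp x g.
Proof. rewrite /emp big_split /= -!mulr_sumr; ring. Qed.

Lemma emp_sum x (I : Type) (t : seq I) (F : I -> (Gam -> A) -> R) :
  emp x (fun y => \sum_(i <- t) F i y) = \sum_(i <- t) emp x (F i).
Proof. by rewrite /emp exchange_big /= mulr_sumr. Qed.

Lemma emp_lip x f g (e : R) : (forall y, `|f y - g y| <= e) ->
  `|emp x f - emp x g| <= e.
Proof.
move=> fge; rewrite -mulrBr -sumrB normrM gtr0_norm ?invr_gt0 ?ltr0n //.
rewrite ler_pdivrMl ?ltr0n //; apply: le_trans (ler_norm_sum _ _ _) _.
rewrite mulr_natl -sumr_const; apply: ler_sum => v _; exact: fge.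
Qed.

(* [index g B = size B] off [B], so [nth] returns [a0] there *)
Definition extend (B : seq Gam) (eta : seq A) : conf :=
  fun g => nth a0 eta (index g B).

Definition pattern (B : seq Gam) (eta : (size B).-tuple A) (y : Gam -> A) : R :=
  (map_tuple y (in_tuple B) == eta)%:R.

Lemma local_pattern B eta : local_on B (@pattern B eta).
Proof.
move=> y z yz; rewrite /pattern -!val_eqE /=.
by congr ((_ == _)%:R); apply/eq_in_map.
Qed.

Lemma pattern_bound B eta y : `|@pattern B eta y| <= 1.
Proof. by rewrite /pattern; case: (_ == _); rewrite ?normr0 ?normr1. Qed.

Lemma pattern_bounded_measurable B eta : bounded_measurable (a0 := a0) (@pattern B eta).
Proof. exact: local_bounded_measurable (@local_pattern B eta) (@pattern_bound B eta). Qed.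

Lemma sum_pattern B (f : (size B).-tuple A -> R) y :
  \sum_eta f eta * @pattern B eta y = f (map_tuple y (in_tuple B)).
Proof.
rewrite (bigD1 (map_tuple y (in_tuple B))) //= /pattern eqxx mulr1 big1 ?addr0 //.
by move=> eta /negbTE; rewrite eq_sym => ->; rewrite mulr0.
Qed.

(** A 1-Lipschitz function is within [3 (2/3)^n] of a combination of patterns on the ball. The
    replacement is made under both measures, and the coefficients are bounded by 3. *)
Lemma dbar_emp_le (x : {ffun V -> A}) n (e : R) :
  (forall eta : (size (ball gl s n)).-tuple A,
     `|emp x (@pattern (ball gl s n) eta) - mean mu (@pattern (ball gl s n) eta)| <= e) ->
  (dbar_emp gl s sig mu x <=
    (6 * (2 / 3) ^+ n + 3 * #|{: (size (ball gl s n)).-tuple A}|%:R * e)%:E)%E.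
Proof.
set B := ball gl s n => xe; apply: ge_ereal_sup => _ [f fL <-].
have fb := Lip1_bounded_measurable fL.
rewrite int_meas_mean // [int_emp _ _ _](_ : _ = (emp x f)%:E); last by [].
rewrite -EFinB abse_EFin lee_fin.
(* Lipschitz functions are bounded uniformly only up to an additive constant, so one value is
   subtracted first. *)
pose k := f (fun=> a0); pose w (eta : (size B).-tuple A) := f (extend B eta) - k.
have w3 eta : `|w eta| <= 3 by apply: (Lip1_le fL); exact: confdist_fin.
pose F eta y := w eta * pattern eta y + 0 * 0.
have Fb eta : bounded_measurable (a0 := a0) (F eta).
  apply: bounded_measurable_affine; first exact: pattern_bounded_measurable.
  exact: bounded_measurable_cst.
have [Sb Sm] := bounded_measurable_sum mu (index_enum _) Fb.
pose S y := \sum_eta F eta y.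
pose g y := 1 * S y + k * 1.
have gb : bounded_measurable (a0 := a0) g.
  by apply: bounded_measurable_affine => //; exact: bounded_measurable_cst.
have SE y : S y = w (map_tuple y (in_tuple B)).
  by rewrite -(sum_pattern w); apply: eq_bigr => eta _; rewrite /F mulr0 addr0.
have fg y : `|f y - g y| <= 3 * (2 / 3) ^+ n.
  rewrite /g SE /w mul1r mulr1 subrK; apply: (Lip1_le fL).
  apply: confdist_le => // u un; rewrite /extend /=.
  have uB : u \in B by rewrite mem_ball // ltnW.
  by rewrite (nth_map u) ?index_mem // nth_index.
have mfg := mean_lip mu fb gb fg.
have efg := emp_lip x fg.
have mF eta : mean mu (F eta) = w eta * mean mu (@pattern B eta).
  rewrite mean_affine ?mul0r ?addr0 //; first exact: pattern_bounded_measurable.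
  exact: bounded_measurable_cst.
have eF eta : emp x (F eta) = w eta * emp x (@pattern B eta).
  by rewrite emp_affine mul0r addr0.
have gg : `|mean mu g - emp x g| <= 3 * #|{: (size B).-tuple A}|%:R * e.
  rewrite /g mean_affine //; last exact: bounded_measurable_cst.
  rewrite emp_affine emp_cst mean_cst emp_sum [mean mu S]Sm !mul1r.
  rewrite opprD addrACA subrr addr0 -sumrB.
  apply: le_trans (ler_norm_sum _ _ _) _.
  rewrite -mulrA mulrCA mulr_natl -sumr_const; apply: ler_sum => eta _.
  by rewrite mF eF -mulrBr normrM ler_pM // distrC.
have -> : mean mu f - emp x f =
  (mean mu f - mean mu g) + (mean mu g - emp x g) - (emp x f - emp x g) by ring.
apply: le_trans (ler_normB _ _) _; apply: le_trans (lerD (ler_normD _ _) (lexx _)) _.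
lra.
Qed.

(** Configurations that differ on the ball are at distance at least [kappa^-n], while [f] varies by
    at most 2; hence [f / (2 kappa^n)] is 1-Lipschitz. *)
Lemma dbar_emp_local (x : {ffun V -> A}) n (e : R) f : local_on (ball gl s n) f ->
  (forall y, `|f y| <= 1) -> (dbar_emp gl s sig mu x < e%:E)%E ->
  `|emp x f - mean mu f| <= 2 * kappa ^+ n * e.
Proof.
move=> fB f1 dx.
pose M : R := 2 * kappa ^+ n.
have k0 : 0 < kappa by apply: lt_le_trans (kappa_ge1 _ r_gt0).
have M0 : 0 < M by rewrite mulr_gt0 // exprn_gt0.
pose g y := M^-1 * f y + 0 * 0.
have fb : bounded_measurable (a0 := a0) f by exact: local_bounded_measurable fB f1.
have gb : bounded_measurable (a0 := a0) g.
  by apply: bounded_measurable_affine => //; exact: bounded_measurable_cst.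
have gL : Lip1 gl s (a0 := a0) g.
  move=> y z; rewrite /g opprD addrACA subrr addr0 -mulrBr.
  have [yz|] := pselect ({in ball gl s n, y =1 z}).
    rewrite (fB _ _ yz) subrr mulr0 normr0.
    by apply: esum_ge0 => u _; rewrite lee_fin mulr_ge0 // invr_ge0 exprn_ge0.
  move=> /existsNP[u /not_implyP[uB /eqP uyz]].
  have un : (wlen gl s u <= n)%N by rewrite -mem_ball.
  apply: (le_trans _ (confdist_ge R r_gt0 un uyz)).
  rewrite lee_fin normrM gtr0_norm ?invr_gt0 // ler_pdivrMl // /M.
  rewrite mulfK ?gt_eqF ?exprn_gt0 //.
  by apply: le_trans (ler_normB _ _) _; rewrite -[2]/(1 + 1) lerD.
have : (`|int_meas mu g - int_emp (a0 := a0) sig x g| <= dbar_emp gl s sig mu x)%E.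
  by apply: ereal_sup_ubound; exists (g : conf -> R).
move=> /le_lt_trans/(_ dx); rewrite int_meas_mean //.
rewrite [int_emp _ _ _](_ : _ = (emp x g)%:E); last by [].
rewrite -EFinB abse_EFin lte_fin mean_affine //; last exact: bounded_measurable_cst.
rewrite emp_affine !mul0r !addr0 -mulrBr normrM gtr0_norm ?invr_gt0 //.
by rewrite ltr_pdivrMl // distrC => /ltW.
Qed.

End Empirical.
End Transport.

(** * Comparison with the local chain on the group *)

Section LocalComparison.
Variables (R : realType) (Gam : countType) (gl : group_law Gam) (r : nat).
Variables (s : 'I_r -> Gam).
Hypothesis Ggen : generates gl s.
Hypothesis r_gt0 : (0 < r)%N.
Variables (A : finType) (a0 : A) (J : A -> A -> R) (h : A -> R).
Variables (V : finType) (sig : Gam -> V -> V).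
Hypothesis sig_hom : is_hom gl sig.
Hypothesis V_gt0 : (0 < #|V|)%N.
Local Notation mul := (gmul gl).
Local Notation kappa := ((3 * r)%:R : R).
Local Notation N := #|V|.
Local Notation view := (pull sig).
Implicit Types (x : V -> A) (v w : V) (g u : Gam) (n k : nat).

Let sigM g1 g2 v : sig (mul g1 g2) v = sig g1 (sig g2 v).
Proof. by case: sig_hom. Qed.

Let sig_inj g : injective (sig g).
Proof. by case: sig_hom => /(_ g) /bij_inj. Qed.

Let sig1 v : sig (gone gl) v = v.
Proof. by apply: (@sig_inj (gone gl)); rewrite -sigM gmul1. Qed.

Definition faithful_at n v := {in ball gl s n &, injective (fun g => sig g v)}.

(** Followed edge by edge along a word, the isomorphism must agree with [g |-> sig g v], which
    inherits its injectivity. *)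
Lemma ball_iso_faithful m n v : (n <= m)%N -> ball_iso gl s sig m v ->
  faithful_at n v.
Proof.
move=> nm [phi [phi1 [_ [phi_inj [_ phi_edge]]]]].
have phiE (w : seq Gam) : is_word gl s w -> (size w <= m)%N ->
    phi (wordval gl w) = sig (wordval gl w) v.
  elim: w => [|a w IH] wS; first by rewrite /= phi1 sig1.
  rewrite /= => wm.
  have wS' : is_word gl s w by move=> b bw; apply: wS; rewrite inE bw orbT.
  have {IH} IHw := IH wS' (ltnW wm).
  have Cw : inCball gl s m (wordval gl w) by exists w; split=> //; split=> //; exact: ltnW.
  have Caw : inCball gl s m (mul a (wordval gl w)) by exists (a :: w).
  have [i [aE|aE]] : inS gl s a by apply: wS; rewrite inE eqxx.
    by rewrite sigM -IHw aE; apply/phi_edge => //; rewrite -aE.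
  (* An inverse generator is an edge traversed backwards: applying [sig (s i)] turns it into a
     forward edge. *)
  apply: (@sig_inj (s i)); rewrite -sigM aE gmulVKg -IHw; symmetry.
  by apply/phi_edge => //; rewrite -?aE // aE gmulVKg.
have ballP g : g \in ball gl s n -> inCball gl s m g /\ phi g = sig g v.
  move=> /(ball_inCball Ggen)[w [wS [wn ->]]]; have wm := leq_trans wn nm.
  by split; [exists w|exact: phiE].
move=> g1 g2 /ballP[C1 E1] /ballP[C2 E2] /= E12.
by apply: phi_inj; rewrite // E1 E2.
Qed.

Lemma faithful_card n v : faithful_at n v -> (size (ball gl s n) <= N)%N.
Proof.
move=> vn; rewrite -(size_map (fun g => sig g v)) [leqRHS]cardE; apply: uniq_leq_size.
  by rewrite map_inj_in_uniq // ball_uniq.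
by move=> w _; rewrite mem_enum.
Qed.

Lemma pull_upd n (T : Type) (f : (Gam -> A) -> T) x v g a :
  faithful_at n v -> g \in ball gl s n -> local_on (ball gl s n) f ->
  f (view (upd x (sig g v) a) v) = f (upd (view x v) g a).
Proof.
move=> vn gn fn; apply: fn => u un.
by rewrite /upd; congr (if _ then _ else _); apply/eqP/eqP => [/vn|->//]; exact.
Qed.

Lemma pull_upd_off n (T : Type) (f : (Gam -> A) -> T) x v w a :
  w \notin [seq sig g v | g <- ball gl s n] -> local_on (ball gl s n) f ->
  f (view (upd x w a) v) = f (view x v).
Proof.
move=> wn fn; apply: fn => u un; rewrite /pull /upd.
by case: eqP => // uw; rewrite -uw map_f in wn.
Qed.

(** Faithfulness to radius [n.+1] is needed because the rate depends on whether a neighbour of [g],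
    possibly outside the ball of radius [n], coincides with [g]. *)
Lemma heat_pull n (f : (Gam -> A) -> R) x v g :
  faithful_at n.+1 v -> g \in ball gl s n -> local_on (ball gl s n.+1) f ->
  heat gl s J h sig (sig g v) (fun y => f (view y v)) x =
  heat gl s J h mul g f (view x v).
Proof.
move=> vn gn fn; have gn1 := ball_subset Ggen (leqnSn n) gn.
apply: eq_bigr => a _; rewrite (pull_upd _ _ vn) //; congr (_ * _).
apply: eq_crate => u uS; last by rewrite /pull sigM.
rewrite -sigM; apply/eqP/eqP => [/vn E|-> //]; apply: E => //.
by move: gn; rewrite !mem_ball // => gn; apply: leq_trans (wlen_mul Ggen _ uS) _.
Qed.

Local Notation QV := (glauber gl s J h sig N (enum V)).
Local Notation QB n := (glauber gl s J h mul N (ball gl s n)).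

(* The two steps differ only through the updates on the sphere of radius
   [n.+1], whose influence on [f] is controlled by the weights. *)
Lemma glauber_pull n (f : (Gam -> A) -> R) x v (D : R) :
  faithful_at n.+1 v -> local_on (ball gl s n.+1) f -> 0 <= D ->
  osc_le f (fun g => D * kappa ^- wlen gl s g) ->
  `|QV (fun y => f (view y v)) x - QB n f (view x v)| <=
  N%:R^-1 * (D * (2 / 3) ^+ n.+1).
Proof.
move=> vn fn D0 fD; rewrite /glauber.
set F := fun y => f (view y v).
pose c w := heat gl s J h sig w F x - F x.
rewrite [X in `|X|](_ : _ = N%:R^-1 * (\sum_(w <- enum V) c w -
  \sum_(g <- ball gl s n) (heat gl s J h mul g f (view x v) - f (view x v)))); last first.
  by rewrite /F; ring.
rewrite normrM ger0_norm ?invr_ge0 // ler_wpM2l ?invr_ge0 //.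
(* Sites outside the image of the ball are invisible to [f], and the ball indexes its image
   injectively. *)
have -> : \sum_(w <- enum V) c w = \sum_(g <- ball gl s n.+1) c (sig g v).
  rewrite -(big_map (fun g => sig g v) predT c).
  set im := [seq _ | g <- _].
  rewrite [RHS]big_uniq /=; last by rewrite map_inj_in_uniq // ball_uniq.
  rewrite big_enum /= (bigID [in im]) /= [X in _ + X]big1 ?addr0 // => w wim.
  rewrite /c /F /heat; under eq_bigr do rewrite (pull_upd_off _ _ wim) //.
  by rewrite -mulr_suml sum_crate mul1r subrr.
rewrite (bigID (fun g => wlen gl s g <= n)%N) /=.
have -> : \sum_(g <- ball gl s n.+1 | (wlen gl s g <= n)%N) c (sig g v) =
    \sum_(g <- ball gl s n) (heat gl s J h mul g f (view x v) - f (view x v)).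
  rewrite -big_filter (perm_big (ball gl s n)) /=.
    by apply: eq_big_seq => g gn; rewrite /c (heat_pull _ vn).
  apply: uniq_perm; rewrite ?filter_uniq ?ball_uniq // => g.
  rewrite mem_filter !mem_ball //; apply/andP/idP => [[]//|gn].
  by split=> //; exact: leq_trans gn (leqnSn n).
rewrite addrAC subrr add0r big_seq_cond.
rewrite (eq_bigl (fun g => (g \in ball gl s n.+1) && (wlen gl s g == n.+1))); last first.
  move=> g; case: (boolP (g \in _)) => //=; rewrite mem_ball // => gn.
  by rewrite -ltnNge eqn_leq gn.
apply: le_trans (ler_norm_sum _ _ _) _.
apply: (@le_trans _ _ (\sum_(g <- ball gl s n.+1 | wlen gl s g == n.+1)
    D * kappa ^- wlen gl s g)); last first.
  by rewrite -mulr_sumr ler_wpM2l // sphere_sum // ball_uniq.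
rewrite -big_seq_cond big_seq_cond [leRHS]big_seq_cond; apply: ler_sum => g /andP[gn _].
apply: heat_sub_le => a; rewrite /F (pull_upd _ _ vn) //; exact: fD.
Qed.

Local Notation growth T := (expR (2 * (size (Sseq gl s)).+1%:R * kappa * T)).

Lemma iter_local n k (f : (Gam -> A) -> R) : local_on (ball gl s n.+1) f ->
  local_on (ball gl s n.+1) (iter k (QB n) f).
Proof. by move=> fn; elim: k => //= k IH; exact: local_glauber. Qed.

(** The one-step errors of [glauber_pull], taken at the local iterates of [f], add up over at most
    [T N] steps. The influence of these iterates exceeds that of [f] at most by the factor
    [growth T]. *)
Lemma iter_pull n k (f : (Gam -> A) -> R) x v (D T : R) :
  faithful_at n.+1 v -> local_on (ball gl s n.+1) f -> 0 <= D ->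
  osc_le f (fun g => D * kappa ^- wlen gl s g) -> k%:R <= T * N%:R ->
  `|iter k QV (fun y => f (view y v)) x - iter k (QB n) f (view x v)| <=
  T * (D * growth T * (2 / 3) ^+ n.+1).
Proof.
move=> vn fn D0 fD kT; set E := D * _ * _.
have E0 : 0 <= E by rewrite !mulr_ge0 ?expR_ge0 ?exprn_ge0.
have BN : (size (ball gl s n) <= N)%N.
  apply: leq_trans (faithful_card vn); apply: uniq_leq_size; first exact: ball_uniq.
  exact: ball_subset.
have oscB j : (j%:R <= T * N%:R) ->
    osc_le (iter j (QB n) f) (fun g => D * growth T * kappa ^- wlen gl s g).
  move=> jT; apply: iter_glauber_osc => //.
  - exact: ball_uniq.
  - exact: (kappa_ge1 R r_gt0).
  - by move=> g _; exact: gmul_inj.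
  - move=> g u gS; have k0 : 0 < kappa by apply: lt_le_trans (kappa_ge1 _ r_gt0).
    rewrite ler_pdivlMr ?exprn_gt0 // mulrC ler_pdivrMr ?exprn_gt0 //.
    by rewrite -exprS ler_weXn2l ?kappa_ge1 // wlen_mul.
suff : `|iter k QV (fun y => f (view y v)) x - iter k (QB n) f (view x v)| <=
    k%:R * (N%:R^-1 * E).
  move=> /le_trans; apply; rewrite mulrA ler_wpM2r // ler_pdivrMr ?ltr0n //.
elim: k kT x => [|k IH] kT x; first by rewrite subrr normr0 mul0r.
have kT' : k%:R <= T * N%:R by apply: le_trans kT; rewrite ler_nat.
rewrite -natr1 mulrDl mul1r.
(* The intermediate term applies one [V]-step to the pulled-back local iterate: contraction of [QV]
   in the sup norm carries the old error, and [glauber_pull] gives the new one. *)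
apply: le_trans (ler_distD (QV (fun y => iter k (QB n) f (view y v)) x) _ _) _.
apply: lerD => /=.
  apply: glauber_lip => //; first by rewrite -cardE.
  by move=> y; exact: IH.
apply: le_trans (glauber_pull x vn (iter_local _ fn) _ (oscB k kT')) _ => //.
by rewrite mulr_ge0 ?expR_ge0.
Qed.

Lemma iter_bound (W : eqType) (nbr : Gam -> W -> W) (L : seq W) k G (M : R) (x : W -> A) :
  (size L <= N)%N -> (forall y, `|G y| <= M) ->
  `|iter k (glauber gl s J h nbr N L) G x| <= M.
Proof.
move=> LN GM; rewrite -[X in `|X|]subr0.
rewrite -(iter_glauber_cst gl s J h nbr N L k 0 x).
by apply: iter_glauber_lip => // y; rewrite subr0.
Qed.

Variable mu : probability (conf Gam a0) R.
Hypothesis mu_gibbs : is_gibbs gl s J h mu.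

Lemma mean_iter n k f : (size (ball gl s n) <= N)%N ->
  local_on (ball gl s n.+1) f -> (forall y, `|f y| <= 1) ->
  mean mu (iter k (QB n) f) = mean mu f.
Proof.
move=> BN fn f1; elim: k => //= k <-.
apply: (mean_glauber Ggen mu_gibbs N (M := 1)).
  exact: iter_local.
by move=> y; apply: iter_bound.
Qed.

(** The three errors are the sphere term at good vertices, at most 2 per bad vertex, and the
    distance between the initial empirical distribution and [mu], tested on the local iterate, whose
    [mu]-mean is that of [f]. *)
Lemma iter_emp n k f (bad : {set V}) (x : {ffun V -> A}) (D T b r0 : R) :
  (size (ball gl s n) <= N)%N ->
  (forall v, v \notin bad -> faithful_at n.+1 v) -> #|bad|%:R <= b * N%:R ->
  local_on (ball gl s n.+1) f -> (forall y, `|f y| <= 1) -> 0 <= D -> 0 <= T ->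
  osc_le f (fun g => D * kappa ^- wlen gl s g) -> k%:R <= T * N%:R ->
  (dbar_emp gl s sig mu x < r0%:E)%E ->
  `|iter k QV (fun y => emp sig y f) x - mean mu f| <=
  T * (D * growth T * (2 / 3) ^+ n.+1) + 2 * b + 2 * kappa ^+ n.+1 * r0.
Proof.
move=> BN goodv badb fn f1 D0 T0 fD kT xr0.
rewrite -(mean_iter k BN fn f1).
set g := iter k (QB n) f.
have gn : local_on (ball gl s n.+1) g by exact: iter_local.
have g1 y : `|g y| <= 1 by exact: iter_bound.
apply: le_trans (ler_distD (emp sig x g) _ _) _.
apply: lerD; last exact: dbar_emp_local gn g1 xr0.
rewrite /emp iter_glauber_sum -mulrBr -sumrB normrM ger0_norm ?invr_ge0 //.
rewrite ler_pdivrMl ?ltr0n //; apply: le_trans (ler_norm_sum _ _ _) _.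
set E := T * _.
have E0 : 0 <= E by rewrite !mulr_ge0 ?expR_ge0 ?exprn_ge0.
apply: (@le_trans _ _ (\sum_(v : V) (E + 2 * (v \in bad)%:R))).
  apply: ler_sum => v _; have [vb|vb] := boolP (v \in bad).
    rewrite mulr1 -[leLHS]add0r lerD //; apply: le_trans (ler_normB _ _) _.
    rewrite -[2]/(1 + 1) lerD //; apply: iter_bound => //.
    by rewrite -cardE.
  by rewrite mulr0 addr0; apply: iter_pull => //; exact: goodv.
rewrite big_split /= sumr_const -mulr_sumr -natr_sum -big_mkcond sum1_card.
rewrite mulrDr -[X in X + _]mulr_natl lerD2l mulrCA ler_pM2l // mulrC.
exact: badb.
Qed.

End LocalComparison.

(** * Concentration and the exit time *)

Section Concentration.
Variables (R : realType) (Gam : countType) (gl : group_law Gam) (r : nat).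
Variables (s : 'I_r -> Gam).
Variables (A : finType) (J : A -> A -> R) (h : A -> R).
Variables (V : finType) (sig : Gam -> V -> V).
Hypothesis sig_hom : is_hom gl sig.
Hypothesis V_gt0 : (0 < #|V|)%N.
Local Notation N := #|V|.
Local Notation view := (pull sig).
Local Notation QV := (glauber gl s J h sig N (enum V)).
Implicit Types (y : V -> A) (v : V) (n m k : nat).

Let sig_inj g : injective (sig g).
Proof. by case: sig_hom => /(_ g) /bij_inj. Qed.

Let size_enum : (size (enum V) <= N)%N. Proof. by rewrite -cardE. Qed.

(** For each [g] in the ball only one vertex [u] satisfies [sig g u = v], so at most
    [size (ball gl s n)] summands change, each by at most 2. *)
Lemma osc_emp n (f : (Gam -> A) -> R) : local_on (ball gl s n) f ->
  (forall z, `|f z| <= 1) ->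
  osc_le (fun y => emp sig y f) (fun=> (2 * (size (ball gl s n))%:R) / N%:R).
Proof.
move=> fn f1 y v a; rewrite /emp -mulrBr -sumrB normrM ger0_norm ?invr_ge0 //.
rewrite mulrC ler_wpM2r ?invr_ge0 //; apply: le_trans (ler_norm_sum _ _ _) _.
apply: (@le_trans _ _
   (\sum_(u : V) \sum_(g <- ball gl s n) 2 * (v == sig g u)%:R)).
  apply: ler_sum => u _.
  have [vn|vn] := boolP (v \in [seq sig g u | g <- ball gl s n]); last first.
    rewrite (pull_upd_off _ _ vn) // subrr normr0.
    by apply: sumr_ge0 => g _; rewrite mulr_ge0.
  apply: (@le_trans _ _ 2).
    by apply: le_trans (ler_normB _ _) _; rewrite -[2]/(1 + 1) lerD.
  have /mapP[g gn vE] := vn; rewrite (big_rem _ gn) /= vE eqxx mulr1 lerDl.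
  by apply: sumr_ge0 => g' _; rewrite mulr_ge0.
have -> : 2 * (size (ball gl s n))%:R = \sum_(g <- ball gl s n) 2 :> R.
  by rewrite big_const_seq count_predT iter_addr_0 mulr_natr.
rewrite exchange_big /=; apply: ler_sum => g _.
rewrite -mulr_sumr ler_piMr // -natr_sum -big_mkcond /= sum1dep_card.
rewrite -[1]/(1%:R) ler_nat -(card1 v) -(card_imset _ (@sig_inj g)); apply: subset_leq_card.
by apply/fintype.subsetP => _ /imsetP[u + ->]; rewrite !inE eq_sym.
Qed.

Local Notation growth T := (expR (2 * (size (Sseq gl s)).+1%:R * 1 * T)).

(** The influence bound is used with constant weight 1 and [kappa = 1]: at most [T N] increments of
    order [1 / N] give a variance of order [1 / N]. *)
Lemma iter_emp_variance n k (f : (Gam -> A) -> R) y (T : R) :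
  local_on (ball gl s n) f -> (forall z, `|f z| <= 1) -> k%:R <= T * N%:R ->
  iter k QV (fun z => emp sig z f ^+ 2) y - (iter k QV (fun z => emp sig z f) y) ^+ 2
  <= T * (2 * (size (ball gl s n))%:R * growth T) ^+ 2 / N%:R.
Proof.
move=> fn f1 kT; set b := 2 * _.
have b0 : 0 <= b by rewrite mulr_ge0.
have N0 : N%:R != 0 :> R by rewrite pnatr_eq0 -lt0n.
apply: (@le_trans _ _ (k%:R * (b / N%:R * growth T) ^+ 2)).
  apply: (iter_glauber_variance V_gt0 size_enum _ (e := fun=> b / N%:R * growth T)).
    by move=> j _; rewrite lexx andbT mulr_ge0 ?expR_ge0 ?divr_ge0.
  move=> j jk x v a; rewrite -[leRHS]mulr1.
  apply: (iter_glauber_osc J h V_gt0 size_enum (wt := fun=> 1)) => //.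
  - exact: enum_uniq.
  - by move=> g _ w; rewrite mulr1.
  - by rewrite divr_ge0.
  - by apply: le_trans kT; rewrite ler_nat ltnW.
  - by move=> z w c; rewrite mulr1; exact: osc_emp.
apply: le_trans (ler_wpM2r (sqr_ge0 _) kT) _.
by rewrite le_eqVlt; apply/orP; left; apply/eqP; field.
Qed.

Lemma iter_second_moment k (F : (V -> A) -> R) y (c : R) :
  iter k QV (fun z => (F z - c) ^+ 2) y =
  iter k QV (fun z => F z ^+ 2) y - iter k QV F y ^+ 2 + (iter k QV F y - c) ^+ 2.
Proof.
have -> : (fun z => (F z - c) ^+ 2) =
  (fun z => 1 * F z ^+ 2 + 1 * ((- 2 * c) * F z + (c ^+ 2) * 1)).
  by apply: funext => z; ring.
rewrite !iter_glauber_affine iter_glauber_cst; ring.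
Qed.

(** The function [psi] stands for the indicator that some [F i] is far from [c i]; the sum of the
    squared deviations over [e ^+ 2] dominates it, giving Chebyshev and the union bound at once. *)
Lemma iter_chebyshev (I : finType) (F : I -> (V -> A) -> R) (c : I -> R)
    (psi : (V -> A) -> R) k y (e a : R) : 0 < e ->
  (forall z, psi z <= 1) ->
  (forall z, (forall i, `|F i z - c i| < e) -> psi z <= 0) ->
  (forall i, iter k QV (fun z => (F i z - c i) ^+ 2) y <= a) ->
  iter k QV psi y <= e ^- 2 * (#|I|%:R * a).
Proof.
move=> e0 psi1 psi0 Fa.
apply: (@le_trans _ _ (iter k QV (fun z => e ^- 2 * \sum_i (F i z - c i) ^+ 2) y)).
  apply: iter_glauber_le => // z.
  have sq_ge0 : 0 <= \sum_i (F i z - c i) ^+ 2.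
    by apply: sumr_ge0 => i _; exact: sqr_ge0.
  have [zF|] := pselect (forall i, `|F i z - c i| < e).
    apply: le_trans (psi0 z zF) _; rewrite mulr_ge0 // invr_ge0.
    by rewrite exprn_ge0 // ltW.
  move=> /existsNP[i /negP]; rewrite -leNgt => ei.
  apply: le_trans (psi1 z) _; rewrite ler_pdivlMl ?exprn_gt0 // mulr1.
  rewrite (bigD1 i) //= -[leLHS]addr0 lerD //.
    by rewrite -[leRHS]real_normK ?num_real // lerXn2r ?nnegrE // ltW.
  by apply: sumr_ge0 => j _; exact: sqr_ge0.
rewrite iter_glauber_sum ler_wpM2l ?invr_ge0 ?exprn_ge0 ?(ltW e0) //.
apply: (@le_trans _ _ (\sum_(i : I) a)); first by apply: ler_sum => i _; exact: Fa.
by rewrite sumr_const mulr_natl.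
Qed.

Lemma sum_Kjump (p : {ffun V -> A} -> R) (x : {ffun V -> A}) :
  \sum_y Kjump gl s sig J h x y * p y =
  N%:R^-1 * \sum_(v <- enum V) \sum_a crate gl s J h sig x v a * p (updf x v a).
Proof.
rewrite /Kjump; under eq_bigr do rewrite -mulrA mulr_suml.
rewrite -mulr_sumr exchange_big big_enum /=; congr (_ * _).
apply: eq_bigr => v _; under eq_bigr do rewrite mulr_suml.
rewrite exchange_big /=; apply: eq_bigr => a _.
rewrite (bigD1 (updf x v a)) //= eqxx mulr1 big1 ?addr0 // => y /negbTE ->.
by rewrite mulr0 mul0r.
Qed.

Lemma updfE (x : {ffun V -> A}) v a : updf x v a = upd x v a :> (V -> A).
Proof. by apply: funext => w; rewrite ffunE. Qed.

(** With [L = enum V] the holding probability of [glauber] is 0, so both sides average over the same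
    single-site updates. *)
Lemma sum_Kjump_ge (p : {ffun V -> A} -> R) (G : (V -> A) -> R) (x : {ffun V -> A}) :
  (forall v a, G (updf x v a) <= p (updf x v a)) ->
  QV G x <= \sum_y Kjump gl s sig J h x y * p y.
Proof.
move=> Gp; rewrite sum_Kjump glauberE -cardE mulVf ?subrr ?mul0r ?add0r; last first.
  by rewrite pnatr_eq0 -lt0n.
rewrite ler_wpM2l ?invr_ge0 //; apply: ler_sum => v _; apply: ler_sum => a _.
by rewrite ler_wpM2l ?crate_ge0 // -updfE.
Qed.

Lemma stayN_ge0 B n (x : {ffun V -> A}) : 0 <= stayN gl s sig J h B n x :> R.
Proof.
elim: n x => [|n IH] x /=; first by [].
rewrite mulr_ge0 //; apply: sumr_ge0 => y _; rewrite mulr_ge0 //.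
rewrite /Kjump mulr_ge0 ?invr_ge0 //; do 2 (apply: sumr_ge0 => ? _).
by rewrite mulr_ge0 ?crate_ge0.
Qed.

(* [near i] holds for at most [m] further steps, so [B] can only be left if
   [near 0] fails at one of the times divisible by [m]. *)
Lemma stayN_grid (B : set {ffun V -> A}) (near : nat -> (V -> A) -> Prop)
    (psi : (V -> A) -> R) m : (0 < m)%N ->
  (forall i (x : {ffun V -> A}), (i <= m)%N -> near i x -> B x) ->
  (forall i y v a, near i y -> near i.+1 (upd y v a)) ->
  (forall y, 0 <= psi y) -> (forall y, near 0 y \/ 1 <= psi y) ->
  forall n (x : {ffun V -> A}),
  1 - \sum_(0 <= k < n.+1 | (m %| k)%N) iter k QV psi x <= stayN gl s sig J h B n x.
Proof.
move=> m0 nearB nearS psi0 psi1.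
have iter0 k y : 0 <= iter k QV psi y.
  rewrite -[leLHS](iter_glauber_cst gl s J h sig N (enum V) k 0 y).
  exact: iter_glauber_le.
have sum0 n i y : 0 <= \sum_(0 <= k < n | (m %| k + i)%N) iter k QV psi y.
  by apply: sumr_ge0 => k _; exact: iter0.
(* Here [i] counts the steps since the last grid time, so the next grid times are the [k] with [m]
   dividing [k + i]. *)
have gen n i (x : {ffun V -> A}) : (i <= m)%N -> near i x ->
    1 - \sum_(0 <= k < n.+1 | (m %| k + i)%N) iter k QV psi x <=
    stayN gl s sig J h B n x.
  elim: n i x => [|n IH] i x im nix.
    rewrite /= [ `[< _ >] ](_ : _ = true); last by apply/asboolP; exact: nearB nix.
    by rewrite gerBl.
  have step j : (j < m)%N -> near j x ->
      1 - \sum_(0 <= k < n.+2 | (m %| k + j)%N) iter k QV psi x <=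
      stayN gl s sig J h B n.+1 x.
    move=> jm njx /=; rewrite [ `[< _ >] ](_ : _ = true) ?mul1r; last first.
      by apply/asboolP; exact: nearB (ltnW jm) njx.
    pose l := [seq k <- index_iota 0 n.+1 | (m %| k + j.+1)%N].
    pose G (y : V -> A) := 1 * 1 + -1 * (1 * \sum_(k <- l) iter k QV psi y).
    have QG := iter_glauber_sum gl s J h sig N (enum V) 1 l 1 (fun k => iter k QV psi) x.
    apply: le_trans (sum_Kjump_ge (G := G) _); last first.
      move=> v a; rewrite /G mul1r mul1r mulN1r big_filter; apply: IH => //.
      by rewrite updfE; exact: nearS.
    rewrite /G glauber_affine glauber_cst.
    rewrite [QV _ x]QG !mul1r mulN1r lerD2l lerN2.
    rewrite big_filter [leRHS]big_ltn_cond // [\sum_(1 <= k < _ | _) _]big_add1 /=.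
    rewrite (eq_bigl (fun k => m %| k.+1 + j)%N); last first.
      by move=> k; rewrite addSnnS.
    by case: ifP => // _; rewrite lerDr; exact: psi0.
  (* At [i = m] a grid time is reached: either [near 0] holds and the count restarts at 0, or the
     term [k = 0] makes the left side nonpositive. *)
  move: im; rewrite leq_eqVlt => /orP[/eqP im|]; last by move=> /step; exact.
  have [n0x|psix] := psi1 x.
    rewrite im (eq_bigl (fun k => m %| k + 0)%N); first exact: step.
    by move=> k; rewrite addn0 dvdn_addl.
  apply: le_trans (stayN_ge0 _ _ _); rewrite subr_le0 im.
  rewrite big_ltn_cond // add0n dvdnn; apply: le_trans psix _ => /=; rewrite lerDl.
  by apply: sumr_ge0 => k _; exact: iter0.
move=> n x; have [n0x|psix] := psi1 x.
  rewrite (eq_bigl (fun k => m %| k + 0)%N); first exact: gen.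
  by move=> k; rewrite addn0.
apply: le_trans (stayN_ge0 _ _ _); rewrite subr_le0.
rewrite big_ltn_cond // dvdn0; apply: le_trans psix _ => /=; rewrite lerDl.
by apply: sumr_ge0 => k _; exact: iter0.
Qed.

Lemma sum_dvd_le n m (F : nat -> R) (b : R) : (0 < m)%N -> 0 <= b ->
  (forall k, (k <= n)%N -> F k <= b) ->
  \sum_(0 <= k < n.+1 | (m %| k)%N) F k <= (n%:R / m%:R + 1) * b.
Proof.
move=> m0 b0 Fb.
apply: (@le_trans _ _ (\sum_(0 <= k < n.+1 | (m %| k)%N) b)).
  rewrite big_nat_cond [leRHS]big_nat_cond; apply: ler_sum => k /andP[/andP[_ kn] _].
  exact: Fb.
rewrite big_ltn_cond // dvdn0 big_mkcond /=.
rewrite (eq_bigr (fun k => (m %| k)%N%:R * b)) => [|k _]; last first.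
  by case: (_ %| _)%N; rewrite ?mul1r ?mul0r.
rewrite -mulr_suml -natr_sum -divn_count_dvd addrC mulrDl mul1r lerD2r ler_wpM2r //.
by rewrite ler_pdivlMr ?ltr0n // -natrM ler_nat leq_trunc_div.
Qed.

End Concentration.

(** * The Poisson number of clock rings *)

Section Poisson.
Variable R : realType.

Lemma sum_poisson (lam : R) : 0 < lam ->
  (\sum_(0 <= n <oo) (expR (- lam) * lam ^+ n / n`!%:R)%:E = 1)%E.
Proof.
move=> lam0.
have P1 : poisson_prob lam 0 [set: nat] = 1%E by exact: probability_setT.
rewrite -P1 /poisson_prob lam0.
rewrite -nneseries_esumT; last by move=> *; rewrite lee_fin poisson_pmf_ge0.
apply: eq_eseriesr => n _; rewrite /poisson_pmf lam0; congr (_%:E); ring.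
Qed.

(** Markov's inequality: more than [M] rings occur with probability at most [lam / M]. *)
Lemma poisson_avg_ge (lam M e : R) (p : nat -> R) : 0 < lam -> 0 < M -> 0 <= e ->
  (forall n, 0 <= p n) -> (forall n, n%:R <= M -> 1 - e <= p n) ->
  ((1 - (e + lam / M))%:E <=
   \sum_(0 <= n <oo) (expR (- lam) * lam ^+ n / n`!%:R * p n)%:E)%E.
Proof.
move=> lam0 M0 e0 p0 pe.
pose q n := expR (- lam) * lam ^+ n / n`!%:R.
have q0 n : 0 <= q n by rewrite /q divr_ge0 ?mulr_ge0 ?expR_ge0 ?exprn_ge0 ?ltW.
have qn0 n : (0%E <= (q n)%:E)%E by rewrite lee_fin.
(* This recursion bounds the mean by [lam]. *)
have qS n : n.+1%:R * q n.+1 = lam * q n.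
  rewrite /q factS natrM exprS; field.
  by rewrite pnatr_eq0 -lt0n fact_gt0 /= addrC natr1 pnatr_eq0.
have q_le1 m : \sum_(0 <= n < m) q n <= 1.
  rewrite -lee_fin -(sum_poisson lam0) -sumEFin.
  by apply: (nneseries_lim_ge m) => *; exact: qn0.
have mean_le m : \sum_(0 <= n < m) n%:R * q n <= lam.
  case: m => [|m]; first by rewrite big_geq // ltW.
  rewrite big_nat_recl // mul0r add0r; under eq_bigr do rewrite qS.
  by rewrite -mulr_sumr ler_piMr // ltW.
(* Termwise form of Markov's inequality: [1 - e - n / M <= p n], trivially when [n > M], since then
   the left side is negative. *)
have pq n : q n - (e * q n + n%:R * q n / M) <= q n * p n.
  have [/pe|Mn] := leP n%:R M.
    move=> /(ler_wpM2l (q0 n)) qp; apply: (le_trans _ qp).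
    have : 0 <= n%:R * q n / M by apply: divr_ge0; [exact: mulr_ge0|exact: ltW].
    lra.
  apply: (@le_trans _ _ 0); last by rewrite mulr_ge0.
  have : q n <= n%:R * q n / M.
    by rewrite mulrAC ler_peMl // ler_pdivlMr // mul1r ltW.
  by have := mulr_ge0 e0 (q0 n); lra.
have part m : \sum_(0 <= n < m) q n - (e + lam / M) <= \sum_(0 <= n < m) q n * p n.
  apply: le_trans (ler_sum _ (fun n _ => pq n)).
  rewrite sumrB lerD2l lerN2 big_split /= -mulr_sumr -mulr_suml lerD //.
    by rewrite ler_piMr.
  by rewrite ler_pM2r ?invr_gt0.
rewrite EFinB leeBlDr // -(sum_poisson lam0).
apply: lime_le.
  by apply: is_cvg_nneseries => *; exact: qn0.
apply: nearW => m; rewrite sumEFin -leeBlDr // -EFinB.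
apply: le_trans (_ : (\sum_(0 <= n < m) q n * p n)%:E <= _)%E.
  by rewrite lee_fin part.
rewrite -sumEFin; apply: (nneseries_lim_ge m) => *.
by rewrite lee_fin mulr_ge0.
Qed.

End Poisson.

(** * Staying near the Gibbs measure *)

Section Stay.
Variables (R : realType) (Gam : countType) (gl : group_law Gam) (r : nat).
Variables (s : 'I_r -> Gam).
Hypothesis Ggen : generates gl s.
Hypothesis r_gt0 : (0 < r)%N.
Variables (A : finType) (a0 : A) (J : A -> A -> R) (h : A -> R).
Local Notation kappa := ((3 * r)%:R : R).

(** A pattern changes by at most 1, and only through sites of the ball, where the weight times
    [kappa ^+ n] is at least 1. *)
Lemma osc_pattern n (eta : (size (ball gl s n)).-tuple A) :
  osc_le (pattern R eta) (fun g => kappa ^+ n * kappa ^- wlen gl s g).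
Proof.
move=> x g a; have k0 : 0 < kappa by apply: lt_le_trans (kappa_ge1 _ r_gt0).
have [gn|gn] := boolP (g \in ball gl s n); last first.
  have -> : pattern R eta (upd x g a) = pattern R eta x.
    apply: local_pattern => u un; rewrite /upd; case: eqP => // ug.
    by rewrite -ug un in gn.
  by rewrite subrr normr0 divr_ge0 ?exprn_ge0.
apply: (@le_trans _ _ 1).
  by rewrite /pattern; case: (_ == _); case: (_ == _); rewrite ?subrr ?subr0 ?sub0r ?normrN ?normr0 ?normr1.
by rewrite ler_pdivlMr ?exprn_gt0 // mul1r ler_weXn2l ?kappa_ge1 // -mem_ball.
Qed.

Variables (V : finType) (sig : Gam -> V -> V).
Hypothesis sig_hom : is_hom gl sig.
Hypothesis V_gt0 : (0 < #|V|)%N.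
Variable mu : probability (conf Gam a0) R.
Local Notation N := #|V|.
Local Notation QV := (glauber gl s J h sig N (enum V)).

(** Deviations below [e] at a grid time stay below [2 e] until the next one, since [m] steps move
    each average by at most [e]. Chebyshev bounds the failure at each of the at most [j / m + 1]
    grid times. *)
Lemma stayN_ge n (B : set {ffun V -> A}) (x : {ffun V -> A}) m K (e a : R) :
  (0 < m)%N -> 0 < e -> 0 <= a ->
  m%:R * (2 * (size (ball gl s n))%:R / N%:R) <= e ->
  (forall y : {ffun V -> A}, (forall eta : (size (ball gl s n)).-tuple A,
      `|emp sig y (pattern R eta) - mean mu (pattern R eta)| <= 2 * e) -> B y) ->
  (forall k (eta : (size (ball gl s n)).-tuple A), (k <= K)%N ->
      iter k QV (fun z => (emp sig z (pattern R eta) - mean mu (pattern R eta)) ^+ 2) x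
      <= a) ->
  forall j, (j <= K)%N ->
  1 - (j%:R / m%:R + 1) * (e ^- 2 * (#|{: (size (ball gl s n)).-tuple A}|%:R * a))
    <= stayN gl s sig J h B j x.
Proof.
move=> m0 e0 a0' me nearB xa j jK.
set L := 2 * _ / _ in me.
have L0 : 0 <= L by rewrite divr_ge0 ?mulr_ge0.
pose F (eta : (size (ball gl s n)).-tuple A) (y : V -> A) := emp sig y (pattern R eta).
pose c (eta : (size (ball gl s n)).-tuple A) := mean mu (pattern R eta).
pose near i (y : V -> A) := forall eta, `|F eta y - c eta| < e + i%:R * L.
pose psi y : R := (~~ `[< near 0%N y >])%:R.
apply: (le_trans _ (stayN_grid gl s J h sig V_gt0 (near := near) (psi := psi) m0 _ _ _ _ j x)).
- rewrite lerD2l lerN2; apply: sum_dvd_le => //.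
    by rewrite mulr_ge0 ?invr_ge0 ?exprn_ge0 ?mulr_ge0 // ltW.
  move=> k kj; apply: (iter_chebyshev V_gt0 (F := F) (c := c)) => //.
  + by move=> z; rewrite /psi; case: (~~ _).
  + move=> z zF; rewrite /psi asboolT // => eta.
    by rewrite mul0r addr0; exact: zF.
  + by move=> eta; apply: xa; exact: leq_trans kj jK.
- move=> i y im ny; apply: nearB => eta; apply: ltW.
  apply: lt_le_trans (ny eta) _.
  have : i%:R * L <= m%:R * L by rewrite ler_wpM2r // ler_nat.
  lra.
- move=> i y v b ny eta; rewrite -natr1 mulrDl mul1r addrA.
  have osc := osc_emp sig_hom (@local_pattern _ R _ _ eta) (@pattern_bound _ R _ _ eta) y v b.
  apply: le_lt_trans (ler_distD (F eta y) _ _) _.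
  by rewrite [ltLHS]addrC; apply: ltr_leD; [exact: ny|exact: osc].
- by move=> y; rewrite /psi.
- move=> y; rewrite /psi; have [ny|ny] := pselect (near 0%N y); [by left|right].
  by rewrite asboolF.
Qed.

End Stay.

(** * Size of the model and good vertices *)

Lemma pow23_small (R : realType) (c : R) : 0 < c ->
  exists n, forall k, (n <= k)%N -> (2 / 3) ^+ k <= c.
Proof.
move=> c0; have [n _ nP] := (proj1 (cvgrPdist_le _ _) (@cvg_geometric23 R)) c c0.
exists n => k nk; have := nP k nk.
rewrite /= sub0r normrN ger0_norm ?mulr_ge0 ?exprn_ge0 //.
have : 0 <= (2 / 3) ^+ k :> R by rewrite exprn_ge0.
lra.
Qed.

Lemma generates_gt0 (Gam : countType) (gl : group_law Gam) r (s : 'I_r -> Gam) :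
  infinite_set [set: Gam] -> generates gl s -> (0 < r)%N.
Proof.
case: r s => // s Ginf Ggen; exfalso; apply: Ginf.
rewrite (_ : [set: Gam] = [set gone gl]); first exact: finite_set1.
apply/seteqP; split=> // g _ /=; have [[|a w] [wS <-//]] := Ggen g.
by have [[]] := wS a (mem_head a w).
Qed.

(** On an empty [V] the empirical functional is 0, so the constant function [e] already forces the
    distance to be at least [e]. *)
Lemma dbar_emp_card_gt0 (R : realType) (Gam : countType) (gl : group_law Gam)
    r (s : 'I_r -> Gam) (A : finType) (a0 : A) (V : finType) (sig : Gam -> V -> V)
    (mu : probability (conf Gam a0) R) (x : {ffun V -> A}) (e : R) :
  (dbar_emp gl s sig mu x < e%:E)%E -> (0 < #|V|)%N.
Proof.
move=> xe; rewrite lt0n; apply/negP => /eqP V0.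
pose f (_ : conf Gam a0) : R := e.
have fL : Lip1 gl s f.
  move=> y z; rewrite subrr normr0; apply: esum_ge0 => g _.
  by rewrite lee_fin mulr_ge0 ?invr_ge0 ?exprn_ge0.
have : (`|int_meas mu f - int_emp sig x f| <= dbar_emp gl s sig mu x)%E.
  by rewrite /dbar_emp /dbarI; apply: ereal_sup_ubound; exists f.
move=> /le_lt_trans/(_ xe).
rewrite int_meas_mean; last exact: bounded_measurable_cst.
rewrite mean_cst /int_emp V0 invr0 mul0r -EFinB abse_EFin lte_fin subr0.
by rewrite ltNge ler_norm.
Qed.

Section Sofic.
Variables (R : realType) (Gam : countType) (gl : group_law Gam) (r : nat).
Variables (s : 'I_r -> Gam).
Hypothesis Ggen : generates gl s.
Variables (V : finType) (sig : Gam -> V -> V).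
Hypothesis sig_hom : is_hom gl sig.
Hypothesis V_gt0 : (0 < #|V|)%N.

(** Some radius realizes the bound on [Delta]. The three thresholds force, in order, that radius to
    be at least [n], a good vertex to exist (hence [V] to be as large as the ball), and the bad
    fraction to be below [b]. *)
Lemma Delta_faithful n (b : R) : 0 < b ->
  Delta gl s R sig < Num.min (9 * (2 / 3) ^+ n) (Num.min 1 (6 * b)) ->
  exists bad : {set V}, [/\ #|bad|%:R <= b * #|V|%:R,
    forall v, v \notin bad -> faithful_at gl s sig n v &
    (size (ball gl s n) <= #|V|)%N].
Proof.
move=> b0 /inf_lt[|_ [Rad _ <-]].
  by exists (9 * (2 / 3) ^+ 0 + 6 * delta_R gl s R sig 0); exists 0%N.
rewrite !lt_min => /and3P[H1 H2 H3].
have d0 : 0 <= delta_R gl s R sig Rad by rewrite divr_ge0.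
have p0 : 0 <= (2 / 3) ^+ Rad :> R by rewrite exprn_ge0.
have nRad : (n <= Rad)%N.
  rewrite leqNgt; apply/negP => /ltnW Radn.
  have : (2 / 3) ^+ n <= (2 / 3) ^+ Rad :> R by apply: ler_wiXn2l => //; lra.
  lra.
pose bad := [set v : V | ~~ `[< ball_iso gl s sig Rad v >]]%SET.
have badE : #|bad|%:R = delta_R gl s R sig Rad * #|V|%:R :> R.
  rewrite /delta_R divfK ?pnatr_eq0 -?lt0n //; congr (_%:R); apply: eq_card => v.
  by rewrite !inE; apply/idP/asboolP.
have good v : v \notin bad -> faithful_at gl s sig n v.
  rewrite inE negbK => /asboolP; exact: ball_iso_faithful.
exists bad; split=> //.
  by rewrite badE ler_pM2r ?ltr0n //; lra.
have : (#|bad| < #|V|)%N.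
  rewrite -(ltr_nat R) badE gtr_pMl ?ltr0n //; lra.
have [[v vb] _|allbad] := pselect (exists v, v \notin bad).
  exact: faithful_card (good v vb).
rewrite ltnNge => /negP[]; apply: subset_leq_card; apply/fintype.subsetP => v _.
by apply/negPn/negP => vb; apply: allbad; exists v.
Qed.

End Sofic.

(** * Choice of the constants and conclusion *)

Theorem theorem1
  (R : realType)
  (Gam : countType) (gl : group_law Gam) (r : nat) (s : 'I_r -> Gam)
  (Ginf : infinite_set [set: Gam]) (Ggen : generates gl s)
  (A : finType) (a0 : A)
  (J : A -> A -> R) (hJ : forall a b, J a b = J b a) (h : A -> R)
  (mu : probability (conf Gam a0) R)
  (mu_gibbs : is_gibbs gl s J h mu) (mu_inv : shift_invariant gl mu) :
  forall r1 : R, 0 < r1 ->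
  forall t eps : R, 0 < t -> 0 < eps ->
  exists r0 : R, 0 < r0 /\
  exists del : R, 0 < del /\
  forall (V : finType) (sig : Gam -> V -> V),
    is_hom gl sig -> Delta gl s R sig < del ->
    forall x0 : {ffun V -> A},
      (dbar_emp gl s sig mu x0 < r0%:E)%E ->
      ((1 - eps)%:E <=
         glauber_stay_prob gl s sig J h t
           [set x | (dbar_emp gl s sig mu x < r1%:E)%E] x0)%E.
Proof.
move=> r1 r1_gt0 t eps t0 eps0.
have r_gt0 := generates_gt0 Ginf Ggen.
have k0 : 0 < (3 * r)%:R :> R by apply: lt_le_trans (kappa_ge1 _ r_gt0).
(* More than [T N] rings then have probability at most [N t / (T N) = eps / 2]. Defining constants
   by equations keeps them opaque. *)
have [T TE] : exists z : R, z = 2 * t / eps by eexists.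
have T0 : 0 < T by rewrite TE divr_gt0 ?mulr_gt0.
have [n0 n0P] : exists n, forall k, (n <= k)%N -> (2 / 3) ^+ k <= r1 / 12.
  by apply: pow23_small; rewrite divr_gt0.
have [P PE] : exists z : R, z = #|{: (size (ball gl s n0)).-tuple A}|%:R by eexists.
have P0 : 0 <= P by rewrite PE.
have P1 : 0 < P + 1 by rewrite ltr_wpDl.
(* Deviations of [2 e] in all patterns cost less than [r1 / 2]; the choice of [n0] leaves the other
   half for truncation. *)
have [e eE] : exists z : R, z = r1 / (12 * (P + 1)) by eexists.
have e0 : 0 < e by rewrite eE divr_gt0 // mulr_gt0.
have eP : 3 * P * (2 * e) < r1 / 2.
  have -> : r1 / 2 = 3 * (P + 1) * (2 * e) by rewrite eE; field; rewrite gt_eqF.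
  by rewrite ltr_pM2r ?mulr_gt0 // ltr_pM2l // ltrDl.
have [L LE] : exists z : R, z = 2 * (size (ball gl s n0))%:R by eexists.
have L0 : 0 < L.
  rewrite LE mulr_gt0 // ltr0n.
  case E : (ball gl s n0) (mem_ball Ggen n0 (gone gl)) => //.
  by rewrite wlen1.
(* In [tau N] steps an empirical average moves by at most [tau L = e]. *)
have [tau tauE] : exists z : R, z = e / L by eexists.
have tau0 : 0 < tau by rewrite tauE divr_gt0.
(* A bound on the number of grid times, the mesh [m] being at least [tau N / 2]. *)
have [M ME] : exists z : R, z = 2 * T / tau + 1 by eexists.
have M0 : 0 < M.
  by rewrite ME ltr_wpDl // divr_ge0 ?mulr_ge0 ?(ltW T0) ?(ltW tau0).
(* The second moment for which the union bound [M e^-2 P theta] is at most [eps / 2]; it is shared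
   between the variance [C / N] and the squared bias [b0 ^+ 2]. *)
have [theta thetaE] : exists z : R, z = eps / (2 * M) * e ^+ 2 / (P + 1) by eexists.
have theta0 : 0 < theta.
  rewrite thetaE; apply: divr_gt0 => //; apply: mulr_gt0; last exact: exprn_gt0.
  by rewrite divr_gt0 // mulr_gt0.
have [C CE] : exists z : R,
    z = T * (L * expR (2 * (size (Sseq gl s)).+1%:R * 1 * T)) ^+ 2 by eexists.
have C0 : 0 <= C by rewrite CE mulr_ge0 ?sqr_ge0 // ltW.
have [b0 [b00 b0sq]] : exists z : R, 0 < z /\ z ^+ 2 <= theta / 2.
  exists (Num.min 1 (theta / 2)); set z := Num.min _ _.
  have z0 : 0 < z by rewrite lt_min ltr01 divr_gt0.
  have z1 : z <= 1 by rewrite ge_min lexx.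
  have zt : z <= theta / 2 by rewrite ge_min lexx orbT.
  by split => //; apply: le_trans zt; rewrite expr2 ler_piMr // ltW.
have [D DE] : exists z : R, z = (3 * r)%:R ^+ n0 by eexists.
have D0 : 0 < D by rewrite DE exprn_gt0.
have [G GE] : exists z : R,
    z = expR (2 * (size (Sseq gl s)).+1%:R * (3 * r)%:R * T) by eexists.
have G0 : 0 < G by rewrite GE expR_gt0.
(* The bias [b0] has three equal parts: the sphere term, fixed by [n1]; the bad vertices, of
   fraction [b0 / 6] and counted twice; and the initial distance [b0 / 3 / K]. *)
have [n1 n1P] : exists n, forall k, (n <= k)%N ->
    (2 / 3) ^+ k <= b0 / 3 / (T * (D * G)).
  by apply: pow23_small; rewrite !divr_gt0 ?mulr_gt0.
pose n := maxn n0 n1.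
have [K KE] : exists z : R, z = 2 * (3 * r)%:R ^+ n.+1 by eexists.
have K0 : 0 < K by rewrite KE mulr_gt0 // exprn_gt0.
(* A faithful ball of this radius forces [#|V|] to be large enough for both the mesh and the
   variance. *)
have [n2 n2P] := ball_unbounded Ggen Ginf (Num.truncn (2 / tau + 2 * C / theta)).+1.
pose n3 := maxn n2 n.+1.
have b_gt0 : 0 < b0 / 6 by rewrite divr_gt0.
exists (b0 / 3 / K); split; first by rewrite !divr_gt0.
exists (Num.min (9 * (2 / 3) ^+ n3) (Num.min 1 (6 * (b0 / 6)))); split.
  by rewrite !lt_min; apply/and3P; split=> //; apply: mulr_gt0.
move=> V sig sig_hom Dsig x xr0.
have V_gt0 := dbar_emp_card_gt0 xr0.
have [bad [badb badP n3V]] := Delta_faithful Ggen sig_hom V_gt0 b_gt0 Dsig.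
have [N NE] : exists z : R, z = #|V|%:R by eexists.
have N0 : 0 < N by rewrite NE ltr0n.
have ballV k : (k <= n3)%N -> (size (ball gl s k) <= #|V|)%N.
  move=> kn3; apply: leq_trans n3V; apply: uniq_leq_size; first exact: ball_uniq.
  exact: ball_subset.
have NM : 2 / tau + 2 * C / theta <= N.
  apply: le_trans (ltW (truncnS_gt _)) _; rewrite NE ler_nat.
  by apply: leq_trans n2P (ballV _ _); exact: leq_maxl.
(* From [tau N >= 2], rounding [tau N] down loses at most half of it. *)
have [Ntau NC] : 2 <= tau * N /\ C / N <= theta / 2.
  have h1 : 0 <= 2 / tau by rewrite divr_ge0 // ltW.
  have h2 : 0 <= 2 * C / theta by rewrite divr_ge0 ?mulr_ge0 // ltW.
  have NM1 : 2 / tau <= N by lra.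
  have NM2 : 2 * C / theta <= N by lra.
  split; first by rewrite mulrC -ler_pdivrMr.
  rewrite ler_pdivrMr // in NM2; rewrite ler_pdivrMr //; lra.
pose m := Num.truncn (tau * N).
have /andP[m_le m_gt] : m%:R <= tau * N < m.+1%:R by apply: truncn_itv; lra.
rewrite -natr1 in m_gt.
have m0 : (0 < m)%N by rewrite truncn_gt0; lra.
pose B := [set y | (dbar_emp gl s sig mu y < r1%:E)%E].
have nV : (size (ball gl s n) <= #|V|)%N.
  by apply: ballV; apply: leq_trans (leqnSn n) (leq_maxr _ _).
have moment k (eta : (size (ball gl s n0)).-tuple A) : k%:R <= T * N ->
    iter k (glauber gl s J h sig #|V| (enum V))
      (fun z => (emp sig z (pattern R eta) - mean mu (pattern R eta)) ^+ 2) x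
    <= theta.
  move=> kT; rewrite iter_second_moment //.
  have fn0 : local_on (ball gl s n0) (pattern R eta) by exact: local_pattern.
  have fn : local_on (ball gl s n.+1) (pattern R eta).
    move=> y z yz; apply: fn0 => g gn; apply: yz; apply: ball_subset gn => //.
    exact: leq_trans (leq_maxl _ _) (leqnSn _).
  have f1 z : `|pattern R eta z| <= 1 by exact: pattern_bound.
  rewrite NE in kT.
  have var := iter_emp_variance J h sig_hom V_gt0 x fn0 f1 kT.
  have badP' v : v \notin bad -> faithful_at gl s sig n.+1 v.
    move=> /badP vn; apply: sub_in2 vn => g; apply: ball_subset => //.
    exact: leq_maxr.
  have := iter_emp Ggen r_gt0 sig_hom V_gt0 mu_gibbs nV badP' badb fn f1
     (exprn_ge0 n0 (ltW k0)) (ltW T0) (osc_pattern R Ggen r_gt0 eta) kT xr0.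
  rewrite -DE -GE -KE [K * _]mulrC divfK ?gt_eqF //.
  have : T * (D * G * (2 / 3) ^+ n.+1) <= b0 / 3.
    rewrite mulrA mulrC -ler_pdivlMr ?mulr_gt0 //.
    by apply: n1P; apply: leq_trans (leq_maxr _ _) (leqnSn _).
  set bias := (X in `|X|); move=> small_sphere le_bias.
  have {}le_bias : `|bias| <= b0.
    have -> : b0 = b0 / 3 + 2 * (b0 / 6) + b0 / 3 by field.
    by apply: le_trans le_bias _; rewrite !lerD.
  have bias2 : bias ^+ 2 <= b0 ^+ 2.
    by rewrite -real_normK ?num_real // lerXn2r ?nnegrE // ltW.
  rewrite -LE -CE -NE in var.
  by rewrite [theta]splitr lerD // ?(le_trans var) // (le_trans bias2).
have stay j : j%:R <= T * N -> 1 - eps / 2 <= stayN gl s sig J h B j x.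
  move=> jT.
  have step : m%:R * (2 * (size (ball gl s n0))%:R / #|V|%:R) <= e.
    rewrite -LE -NE mulrA ler_pdivrMr //.
    by move: m_le; rewrite tauE mulrAC ler_pdivlMr.
  have inB (y : {ffun V -> A}) : (forall eta : (size (ball gl s n0)).-tuple A,
      `|emp sig y (pattern R eta) - mean mu (pattern R eta)| <= 2 * e) -> B y.
    move=> yP; apply: le_lt_trans (dbar_emp_le Ggen r_gt0 V_gt0 yP) _.
    rewrite lte_fin -PE; have := n0P n0 (leqnn n0); lra.
  have moment' k (eta : (size (ball gl s n0)).-tuple A) : (k <= j)%N ->
      iter k (glauber gl s J h sig #|V| (enum V))
      (fun z => (emp sig z (pattern R eta) - mean mu (pattern R eta)) ^+ 2) x
      <= theta.
    by move=> kj; apply: moment; apply: le_trans jT; rewrite ler_nat.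
  apply: (le_trans _ (stayN_ge sig_hom V_gt0 m0 e0 (ltW theta0) step inB moment' (leqnn j))).
  rewrite lerD2l lerN2 -PE.
  have jm : j%:R / m%:R + 1 <= M.
    rewrite ME lerD2r ler_pdivrMr ?ltr0n //; apply: le_trans jT _.
    rewrite mulrAC ler_pdivlMr //.
    have -> : T * N * tau = T * (tau * N) by ring.
    have -> : 2 * T * m%:R = T * (2 * m%:R) by ring.
    by rewrite ler_pM2l //; lra.
  have pa : e ^- 2 * (P * theta) <= eps / (2 * M).
    have -> : e ^- 2 * (P * theta) = eps / (2 * M) * (P / (P + 1)).
      by rewrite thetaE; field; rewrite !gt_eqF.
    rewrite ler_piMr ?divr_ge0 ?mulr_ge0 ?(ltW eps0) ?(ltW M0) //.
    by rewrite ler_pdivrMr // mul1r lerDl.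
  apply: (@le_trans _ _ (M * (eps / (2 * M)))).
    apply: ler_pM => //.
    by rewrite !mulr_ge0 ?invr_ge0 ?exprn_ge0 ?(ltW e0) ?(ltW theta0).
  by rewrite le_eqVlt; apply/orP; left; apply/eqP; field; rewrite !gt_eqF.
have TN0 : 0 < T * N by rewrite mulr_gt0.
have lam0 : 0 < N * t by rewrite mulr_gt0.
have eps2 : 0 <= eps / 2 by rewrite divr_ge0 // ltW.
have := poisson_avg_ge lam0 TN0 eps2 (fun j => stayN_ge0 gl s J h sig B j x) stay.
have -> : 1 - (eps / 2 + N * t / (T * N)) = 1 - eps.
  by rewrite TE; field; rewrite !gt_eqF.
by rewrite NE.
Qed.
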